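(* Let $L\ge2$, $\beta\in[L]$, let $S$ be a positive integer with $S<L$, and let $C_0,C_1,C_2,\gamma,\alpha_1,\alpha_2,C_h>0$. There is a constant $\tilde C>0$, depending only on $C_0,C_1,C_2,\alpha_1,\alpha_2,C_h$ (and not on $N,L,\beta,S$), such that the following holds. Suppose that (i) (exponential bound) for every $N\ge1$, all $\delta>0$ and all $l\in[L]$, for $\mathbb P_X$-almost every $x\in\mathbb R^D$, $$\mathbb P^{\otimes N}\{|\eta^l(x)-\hat\eta^l(x)|\ge\delta\}\le C_1\exp(-C_2N^\gamma\delta^2);$$ (ii) (local margin) for all $k\in\{1,\dots,L-1\}$ and all $\delta>0$, $$\mathbb P_X\{\eta^{\sigma_k}(X)-\eta^{\sigma_{k+1}}(X)\le\delta,\ K(X)=k\}\le C_0\delta^{\alpha_1};$$ (iii) (sparsity) $\sum_{l=1}^L\mathbb P\{Y^l=1\mid X\}\le S$, $\mathbb P_X$-almost surely; (iv) (global margin) there is a function $h:\mathbb R_+\to\mathbb R_+$ with $h(0)=1$ and $\sum_{k=\beta}^L\sum_{l=1}^Lh(|k-l|)\le C_h(L-\beta)$ such that for all $k\in\{\beta,\dots,L\}$, all $l\in[k]$ and all $\delta>0$, $$\mathbb P_X\Big\{\frac1l\Big|\sum_{j=k-l+1}^{k}(1-\eta^{\sigma_j}(X))-\beta\Big|\le\delta,\ K(X)=k\Big\}\le\beta^{\alpha_2}\delta^{\alpha_2}h(|k-l|).$$ Then for every $N\ge1$ the plug-in classifier $\hat f$ satisfies $$\mathbb E_{\mathbb P^{\otimes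 N}}\big[\mathcal R(\hat f)\big]-\mathcal R(f^* )\le\tilde C\,(\beta^{\alpha_2}+S)\,\frac{L-\beta}{L}\,N^{-\gamma(\alpha_2\wedge\alpha_1)/2},$$ where $f^*\in\arg\min_{f\in\mathcal F_\beta}\mathcal R(f)$.
   Context: $[L]=\{1,\dots,L\}$, $a\wedge b=\min(a,b)$. $(X,Y)\sim\mathbb P$ with $X\in\mathbb R^D$ and $Y=(Y^1,\dots,Y^L)^\top\in\{0,1\}^L$; $\mathbb P_X$ is the marginal law of $X$. A classifier is a measurable function $f=(f^1,\dots,f^L)^\top:\mathbb R^D\to\{0,1\}^L$; $\mathcal F$ is the set of all classifiers. The risk of $f\in\mathcal F$ is $$\mathcal R(f)=\frac1L\sum_{l=1}^L\mathbb P\{f^l(X)=0,\ Y^l=1\}.$$ The set of classifiers with controlled false positives is $$\mathcal F_\beta=\Big\{f\in\mathcal F:\ \sum_{l=1}^L\mathbb P\{f^l(X)=1,Y^l=0\mid X\}\le\beta,\ \mathbb P_X\text{-a.s.}\Big\}.$$ Regression vector: $\eta(x)=(\eta^1(x),\dots,\eta^L(x))^\top\in[0,1]^L$ with $\eta^l(x)=\mathbb P(Y^l=1\mid X=x)$. For each $x$, $\sigma=\sigma(x)$ is a permutation of $[L]$ (chosen measurably in $x$) with $\eta^{\sigma_1}(x)\ge\dots\ge\eta^{\sigma_L}(x)$, and $$K(x)=\max\Big\{m\in[L]:\ \sum_{l=1}^m(1-\eta^{\sigma_l}(x))\le\beta\Big\}.$$ The data consist of $N$ i.i.d. copies $(X_i,Y_i)_{i=1}^N$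 of $(X,Y)$, with joint law $\mathbb P^{\otimes N}$ and expectation $\mathbb E_{\mathbb P^{\otimes N}}$. For each $N$, $\hat\eta(x)=(\hat\eta^1(x),\dots,\hat\eta^L(x))^\top\in[0,1]^L$ is an estimator of $\eta(x)$, i.e. a (measurable) function of the data and of $x$. For each $x$, $\hat\sigma=\hat\sigma(x)$ is a permutation of $[L]$ (chosen measurably) with $\hat\eta^{\hat\sigma_1}(x)\ge\dots\ge\hat\eta^{\hat\sigma_L}(x)$, and $$\hat K(x)=\max\Big\{m\in[L]:\ \sum_{l=1}^m(1-\hat\eta^{\hat\sigma_l}(x))\le\beta\Big\}.$$ The plug-in classifier $\hat f$ is defined for every $x$, with $\hat K=\hat K(x)$, by $\hat f^{\hat\sigma_1}(x)=\dots=\hat f^{\hat\sigma_{\hat K}}(x)=1$ and $\hat f^{\hat\sigma_{\hat K+1}}(x)=\dots=\hat f^{\hat\sigma_L}(x)=0$. *)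

(* Defs.v *)
From HB Require Import structures.
From mathcomp Require Import all_boot all_order all_algebra all_fingroup.
From mathcomp Require Import all_classical all_reals all_analysis.

Set Implicit Arguments.
Unset Strict Implicit.
Unset Printing Implicit Defensive.

Import Order.TTheory GRing.Theory Num.Theory.

Local Open Scope classical_set_scope.
Local Open Scope ring_scope.

(* R^D is rendered as D.-tuple R and {0,1}^L as L.-tuple bool, both with the
   product sigma-algebra (for R^D this is the Borel one).  The definitions below
   allow any measurable feature space X; the law of the pair (X, Y) is a
   probability on the product, so that X is fst and Y is snd. *)

HB.instance Definition _ {d d' : measure_display} (T : measurableType d)
    (T' : measurableType d') :=
  isMeasurableFun.Build _ _ _ _ (@fst T T') (@measurable_fst _ _ T T').

Section classifiers.
Context {d : measure_display} {X : measurableType d} {R : realType} {L : nat}.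
Implicit Types (P : probability (X * L.-tuple bool)%type R)
  (f : X -> L.-tuple bool).

Definition marginal P : probability X R :=
  distribution P [the {mfun (X * L.-tuple bool)%type >-> X} of fst].

Definition classifier : set (X -> L.-tuple bool) :=
  [set f | measurable_fun setT f].

Definition risk P f : R :=
  L%:R^-1 *
  \sum_(l < L) fine (P [set z | tnth (f z.1) l = false /\ tnth z.2 l = true]).

(* g(X) is a version of the conditional probability P(E | X). *)
Definition is_cond_prob P (E : set (X * L.-tuple bool)) (g : X -> R) : Prop :=
  (marginal P).-integrable setT (EFin \o g) /\
  forall A : set X, measurable A ->
    P (E `&` fst @^-1` A) = (\int[marginal P]_(x in A) (g x)%:E)%E.

(* \sum_l P(E_l | X) <= c almost surely; conditional probabilities being unique
   up to null sets, the choice of the versions is immaterial. *)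
Definition cond_prob_sum_le P (E : 'I_L -> set (X * L.-tuple bool)) (c : R) :
    Prop :=
  exists g : 'I_L -> X -> R, (forall l, is_cond_prob P (E l) (g l)) /\
    {ae marginal P, forall x, \sum_(l < L) g l x <= c}.

Definition controlled_classifier P (beta : R) : set (X -> L.-tuple bool) :=
  [set f | classifier f /\
    cond_prob_sum_le P
      (fun l => [set z | tnth (f z.1) l = true /\ tnth z.2 l = false]) beta].

Definition risk_argmin P (F : set (X -> L.-tuple bool)) :
    set (X -> L.-tuple bool) :=
  [set f | F f /\ forall g, F g -> risk P f <= risk P g].

Definition is_regression P (eta : X -> 'I_L -> R) : Prop :=
  (forall x l, 0 <= eta x l <= 1) /\
  forall l, is_cond_prob P [set z | tnth z.2 l = true] (eta ^~ l).

End classifiers.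

(* Indices are 0-based: the j-th largest score is e (s (j - 1)), the sum over
   j = 1, ..., m is the sum over the ordinals j < m. *)
Section plug_in.
Context {R : realType} {L : nat}.
Implicit Types (e : 'I_L -> R) (s : {perm 'I_L}).

Definition sorts e s : Prop :=
  forall i j : 'I_L, (i <= j)%N -> e (s j) <= e (s i).

(* The maximum over the empty set would be 0; for beta >= 1 and scores in [0, 1]
   the index m = 1 is always admissible. *)
Definition cutoff (beta : R) e s : nat :=
  \max_(m < L.+1 |
    (0 < m)%N && (\sum_(j < L | (j < m)%N) (1 - e (s j)) <= beta)) m.

Definition plug_in (beta : R) e s : L.-tuple bool :=
  [tuple ((s^-1)%g l < cutoff beta e s)%N | l < L].

End plug_in.

(* {perm 'I_L} carries the discrete sigma-algebra. *)
Definition measurable_perm {d : measure_display} {T : measurableType d}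
    {L : nat} (s : T -> {perm 'I_L}) : Prop :=
  forall p : {perm 'I_L}, measurable [set t | s t = p].

Section product_law.
Context {d : measure_display} {T : measurableType d} {R : realType}.

Definition consT N (z : T * N.-tuple T) : N.+1.-tuple T :=
  [tuple of z.1 :: z.2].

Lemma measurable_consT N : measurable_fun setT (@consT N).
Proof. exact: measurable_cons. Qed.

HB.instance Definition _ N :=
  isMeasurableFun.Build _ _ _ _ (@consT N) (@measurable_consT N).

(* The N-fold product measure of P with itself. *)
Fixpoint product_law (P : probability T R) (N : nat) :
    probability (N.-tuple T) R :=
  match N with
  | 0 => [the probability _ _ of dirac [tuple]]
  | N'.+1 => distribution (P \x product_law P N')%E
               [the {mfun (T * N'.-tuple T)%type >-> N'.+1.-tuple T} of @consT N']
  end.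

Lemma product_lawE (P : probability T R) (N : nat) (A : 'I_N -> set T) :
  (forall i, measurable (A i)) ->
  product_law P N [set t | forall i, A i (tnth t i)] = (\prod_(i < N) P (A i))%E.
Proof.
elim: N A => [|N IH] A mA.
  rewrite big_ord0 /= diracE mem_set//= => -[].
  by [].
rewrite big_ord_recl -IH /=; last by move=> i; exact: mA.
rewrite -product_measure1E//.
  rewrite /distribution /pushforward; congr (_ _).
  apply/seteqP; split => -[x t] /=.
    move=> H; split; first exact: (H ord0).
    by move=> i; have := H (lift ord0 i); rewrite tnthS.
  move=> [H0 H] i; case: (unliftP ord0 i) => [j|] ->; last exact: H0.
  by rewrite tnthS; exact: H.
rewrite [X in measurable X](_ : _ =
    \bigcap_(i in [set: 'I_N]) ((@tnth N T ^~ i) @^-1` A (lift ord0 i))).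
  apply: fin_bigcap_measurable => // i _.
  by rewrite -[X in measurable X]setTI; exact: measurable_tnth.
by apply/seteqP; split => t H i; [move=> _; exact: H|exact: (H i I)].
Qed.

End product_law.

(* Main.v *)
(** Write [u_l] for the estimation error of label [l] divided by
[tau = N^(-gamma/2)]; the exponential bound gives uniformly bounded moments
[E (1 + u_l^p)].  The best classifier keeps the [K(x)] best labels, and the
plug-in can only lose against it in two ways.  Either it selects the wrong [K]
labels: then, with [t] the midpoint of the gap at rank [K], the labels wrongly
left out are all estimated below [t] or the labels wrongly selected are all
estimated above [t]; the former are counted with weight [eta^l], of total mass
at most [S], the latter with weight 1, and there are at most [L - beta] of them.
Or its cutoff is smaller than [K]: every rank [i] lost this way forces the mean
error over the [i] best labels to exceed the quantity of the global margin
condition, and convexity of [u |-> u^p] turns this mean into a mean of moments.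
Both conditions are thus paid for by [decay p (margin / tau)] times moments, and
dyadic peeling integrates [decay] against the margin conditions.  Sparsity
forces [beta <= K <= beta + S], so that at most [min (S + 1) (L - beta)] values
of [K] contribute to the first loss, and its weight [S + (L - beta)] is paid for
at most [3 S (L - beta)] in total. *)

Require Import Defs.
From mathcomp Require Import all_boot all_order all_algebra all_fingroup.
From mathcomp Require Import all_classical all_reals all_analysis.
From mathcomp Require Import measurable_realfun.
From mathcomp Require Import zify ring lra.

Set Implicit Arguments.
Unset Strict Implicit.
Unset Printing Implicit Defensive.

Import Order.TTheory GRing.Theory Num.Theory.

Local Open Scope classical_set_scope.
Local Open Scope ring_scope.

(** * Rankings and cutoffs *)

Section ranking.
Context {R : realType} {L : nat}.
Implicit Types (e : 'I_L -> R) (s : {perm 'I_L}).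

Lemma sum_perm_rank (F : 'I_L -> R) s (p : pred nat) :
  \sum_(j < L | p j) F (s j) = \sum_(l | p ((s^-1)%g l)) F l.
Proof.
rewrite [RHS](reindex_inj (@perm_inj _ s)); apply: eq_bigl => j.
by rewrite permK.
Qed.

Lemma card_perm_rank s (p : pred nat) :
  #|[pred l | p ((s^-1)%g l)]| = #|[pred j : 'I_L | p j]|.
Proof.
rewrite -!sum1_card (reindex_inj (@perm_inj _ s)) /=; apply: eq_bigl => j.
by rewrite !inE permK.
Qed.

Lemma card_ord_itv m n : (n <= L)%N ->
  #|[pred j : 'I_L | (m <= j < n)%N]| = (n - m)%N.
Proof.
move=> nL; rewrite -sum1_card.
rewrite -(big_mkord (fun j => (m <= j < n)%N) (fun=> 1%N)).
rewrite (eq_bigl (fun j => (m <= j)%N && (j < n)%N))//.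
rewrite -big_nat_widen//.
under eq_bigl do rewrite /=.
have [mn|nm] := leqP m n; last first.
  rewrite big_nat_cond big1; first by apply/esym/eqP; rewrite subn_eq0 ltnW.
  by move=> i /andP[/andP[_ ?] ?]; lia.
rewrite (@big_cat_nat _ _ _ m)//= [X in (X + _)%N]big_nat_cond big1; last first.
  by move=> i /andP[/andP[_ ?] ?]; lia.
rewrite add0n big_nat_cond (eq_bigl (fun i => m <= i < n)%N); last first.
  by move=> i; lia.
by rewrite -big_nat sum_nat_const_nat muln1.
Qed.

Lemma card_ord_lt m : (m <= L)%N -> #|[pred j : 'I_L | (j < m)%N]| = m.
Proof. by move=> mL; rewrite -[RHS](subn0 m) -(card_ord_itv 0 mL). Qed.

Lemma sum1_ord_lt m : (m <= L)%N -> \sum_(j < L | (j < m)%N) 1 = m%:R :> R.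
Proof.
by move=> mL; rewrite sumr_const; congr (1 *+ _); exact: card_ord_lt.
Qed.

(* Compare both sums after subtracting a threshold separating the [m] best
   scores from the others: the inequality then holds term by term. *)
Lemma sum_le_top e s (F : pred 'I_L) m : sorts e s -> #|F| = m ->
  \sum_(l | F l) e l <= \sum_(j < L | (j < m)%N) e (s j).
Proof.
move=> es Fm.
have mL : (m <= L)%N by rewrite -Fm -[leqRHS]card_ord; exact: max_card.
rewrite (sum_perm_rank e s (fun j => j < m)%N).
case: m Fm mL => [|m] Fm mL.
  rewrite big_pred0; last by move=> l; move/card0_eq : Fm => /(_ l).
  by apply: sumr_ge0.
set t := e (s (Ordinal mL)).
pose T l := ((s^-1)%g l < m.+1)%N.
have Tm : #|T| = m.+1.
  exact: etrans (card_perm_rank s (fun j => j < m.+1)%N) (card_ord_lt mL).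
suff : \sum_(l | F l) (e l - t) <= \sum_(l | T l) (e l - t).
  by rewrite !big_split/= !sumr_const Fm Tm lerD2r.
rewrite [leLHS]big_mkcond [leRHS]big_mkcond/=; apply: ler_sum => l _.
have [Tl|Tl] := boolP (T l).
  have : t <= e l by rewrite -[l](permKV s); apply: es.
  by case: ifP => _; rewrite ?subr_ge0.
case: ifP => // _; rewrite subr_le0 -[l](permKV s).
by apply: es => /=; rewrite leqNgt; apply: contra Tl => /ltnW.
Qed.

Lemma cutoff_le_size (b : R) e s : (cutoff b e s <= L)%N.
Proof. by apply/bigmax_leqP => i _; rewrite -ltnS. Qed.

Lemma leq_cutoff (b : R) e s m : (0 < m <= L)%N ->
  \sum_(j < L | (j < m)%N) (1 - e (s j)) <= b -> (m <= cutoff b e s)%N.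
Proof.
move=> /andP[m0 mL] mb.
have mL1 : (m < L.+1)%N by [].
apply: (@leq_bigmax_cond _ _ (fun i => nat_of_ord i) (Ordinal mL1)).
by rewrite m0.
Qed.

(** The maximum as a finite union over the ranks [m], the form in which the level sets of the cutoff
    are measurable. *)
Lemma lt_cutoffP (b : R) e s (i : nat) :
  (i < cutoff b e s)%N <->
  exists m : 'I_L.+1, [/\ (i < m)%N, (0 < m)%N &
    \sum_(j < L | (j < m)%N) (1 - e (s j)) <= b].
Proof.
split=> [|[m [im m0 mb]]].
  rewrite ltnNge => /negP ik; apply: contrapT => H; apply: ik.
  apply/bigmax_leqP => m /andP[m0 mb]; rewrite leqNgt; apply/negP => im.
  by apply: H; exists m.
by apply: leq_trans im _; apply: leq_cutoff => //; rewrite m0 -ltnS/=.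
Qed.

(** A positive maximum is attained; a cutoff 0 leaves an empty sum, whence [0 <= b]. *)
Lemma cutoff_sum (b : R) e s : 0 <= b ->
  \sum_(j < L | (j < cutoff b e s)%N) (1 - e (s j)) <= b.
Proof.
move=> b0; case E : (cutoff b e s) => [|k]; first by rewrite big_pred0.
have /lt_cutoffP[m [km m0 mb]] : (k < cutoff b e s)%N by rewrite E.
suff <- : m = k.+1 :> nat by [].
apply/eqP; rewrite eqn_leq km andbT -E; apply: leq_cutoff => //.
by rewrite m0 -ltnS/=.
Qed.

(** A selected label costs at most 1, so a budget [beta] always pays for [beta] labels. *)
Lemma leq_beta_cutoff (beta : nat) e s : (forall l, 0 <= e l) ->
  (1 <= beta <= L)%N -> (beta <= cutoff beta%:R e s)%N.
Proof.
move=> e0 b1; apply: leq_cutoff => //.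
apply: (@le_trans _ _ (\sum_(j < L | (j < beta)%N) 1)).
  by apply: ler_sum => j _; rewrite gerBl.
by rewrite sum1_ord_lt//; case/andP: b1.
Qed.

(** The [k] selected labels cost [k] minus their total score, and sparsity bounds that score by
    [S]. *)
Lemma cutoff_leq_sparse (beta S : nat) e s : (forall l, 0 <= e l) ->
  \sum_l e l <= S%:R -> (cutoff beta%:R e s <= beta + S)%N.
Proof.
move=> e0 eS; have := @cutoff_sum beta%:R e s (ler0n _ _).
rewrite big_split/= sumrN sum1_ord_lt ?cutoff_le_size//.
rewrite (sum_perm_rank e s (fun j => j < cutoff beta%:R e s)%N) => H.
have : \sum_(l | ((s^-1)%g l < cutoff beta%:R e s)%N) e l <= \sum_l e l.
  by rewrite [leRHS](bigID (fun l => (s^-1)%g l < cutoff beta%:R e s)%N)/=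
    lerDl sumr_ge0.
by rewrite -(ler_nat R) natrD; lra.
Qed.

Lemma tnth_plug_in (b : R) e s l :
  tnth (plug_in b e s) l = ((s^-1)%g l < cutoff b e s)%N.
Proof. exact: tnth_mktuple. Qed.

(** Pointwise optimality of the oracle. For nonempty [F], the [#|F|] best labels have at least the
    total score of [F], hence cost no more; they fit the budget, so [#|F|] is at most the cutoff. *)
Lemma oracle_loss_le (b : R) e s (F : pred 'I_L) : (forall l, 0 <= e l) ->
  sorts e s -> \sum_(l | F l) (1 - e l) <= b ->
  \sum_(l | ~~ tnth (plug_in b e s) l) e l <= \sum_(l | ~~ F l) e l.
Proof.
move=> e0 es Fb.
suff : \sum_(l | F l) e l <= \sum_(l | tnth (plug_in b e s) l) e l.
  have E (A : pred 'I_L) :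
    \sum_l e l = \sum_(l | A l) e l + \sum_(l | ~~ A l) e l by rewrite (bigID A).
  by have := E (fun l => tnth (plug_in b e s) l); rewrite (E F); lra.
rewrite [leRHS](eq_bigl _ _ (tnth_plug_in b e s)).
rewrite -(sum_perm_rank e s (fun j => j < cutoff b e s)%N).
have Ftop := sum_le_top es (erefl #|F|).
apply: (le_trans Ftop).
have [->|F0] := eqVneq #|F| 0%N.
  by rewrite big_pred0// sumr_ge0.
have FL : (#|F| <= L)%N by rewrite -[leqRHS]card_ord; exact: max_card.
suff Fk : (#|F| <= cutoff b e s)%N.
  rewrite [leRHS](bigID (fun j : 'I_L => j < #|F|)%N)/=.
  rewrite [X in X + _](eq_bigl (fun j : 'I_L => (j < #|F|)%N)); last first.
    by move=> j; apply: andb_idl => /leq_trans; exact.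
  by rewrite lerDl sumr_ge0.
apply: leq_cutoff; first by rewrite lt0n F0.
apply: le_trans Fb; rewrite !big_split/= !sumrN sum1_ord_lt// sumr_const.
by rewrite lerD2l lerN2.
Qed.

(* With [t] the midpoint of the gap of [e] at rank [j], a label wrongly left out
   by the ranking [s'] has an estimate at most [t], unless all the labels
   wrongly selected have an estimate at least [t]. *)
Lemma swap_loss_le e e' s s' (i j : 'I_L) :
  (forall l, 0 <= e l <= 1) -> sorts e s -> sorts e' s' -> j = i.+1 :> nat ->
  \sum_(l < L | (l < j)%N) e (s l) - \sum_(l < L | (l < j)%N) e (s' l) <=
  \sum_(l | (e (s i) - e (s j)) / 2 <= `|e l - e' l|)
     (e l + (j <= (s^-1)%g l)%N%:R).
Proof.
move=> e01 es es' ji.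
have e0 l : 0 <= e l by case/andP: (e01 l).
rewrite (sum_perm_rank e s (fun l => l < j)%N).
rewrite (sum_perm_rank e s' (fun l => l < j)%N).
set t := (e (s i) + e (s j)) / 2; set w := (e (s i) - e (s j)) / 2.
pose A l := ((s^-1)%g l < j)%N; pose A' l := ((s'^-1)%g l < j)%N.
have cA : \sum_(l | A l) 1 = \sum_(l | A' l) 1 :> R.
  by rewrite -(sum_perm_rank (fun=> 1) s (fun l => l < j)%N)
             -(sum_perm_rank (fun=> 1) s' (fun l => l < j)%N).
(* Both selections have the same size, so as many labels are wrongly left out as are wrongly
   selected. *)
have cAA' : \sum_(l | A l && ~~ A' l) 1 = \sum_(l | ~~ A l && A' l) 1 :> R.
  move: cA; rewrite (bigID A')/= [X in _ = X](bigID A)/=.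
  under [X in _ = X + _]eq_bigl do rewrite andbC.
  under [X in _ = _ + X]eq_bigl do rewrite andbC.
  exact: addrI.
have Aw l : A l -> t + w <= e l.
  move=> Al; rewrite (_ : t + w = e (s i)); last by rewrite /t /w; lra.
  by rewrite -[l](permKV s); apply: es; rewrite -ltnS -ji.
have nAw l : ~~ A l -> e l <= t - w.
  move=> Al; rewrite (_ : t - w = e (s j)); last by rewrite /t /w; lra.
  by rewrite -[l](permKV s); apply: es; rewrite leqNgt.
have dif : \sum_(l | A l) e l - \sum_(l | A' l) e l <=
           \sum_(l | A l && ~~ A' l) e l.
  rewrite (bigID A')/= [X in _ - X](bigID A)/=.
  under [X in _ - (X + _)]eq_bigl do rewrite andbC.
  have : 0 <= \sum_(l | A' l && ~~ A l) e l by rewrite sumr_ge0.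
  by lra.
apply: (le_trans dif).
have [H|/existsNP[l0 /not_implyP[/andP[Al0 A'l0] /negP]]] :=
    pselect (forall l, A l && ~~ A' l -> e' l <= t).
  rewrite [leLHS]big_mkcond [leRHS]big_mkcond/=; apply: ler_sum => l _.
  have [AA'|_] := boolP (A l && ~~ A' l); last first.
    by case: ifP => // _; rewrite addr_ge0.
  have := H _ AA'; case/andP: AA' => /Aw H1 _ H2.
  by rewrite ifT ?lerDl//; apply: le_trans (ler_norm _); lra.
rewrite -ltNge => te'.
(* [l0] was left out although estimated above [t]. Whatever [s'] selected is estimated at least as
   high, while the true score of a wrongly selected label is at most [t - w]. *)
have B2 l : ~~ A l && A' l -> w <= `|e l - e' l|.
  move=> /andP[/nAw el A'l]; rewrite distrC; apply: le_trans (ler_norm _).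
  suff : e' l0 <= e' l by lra.
  rewrite -[l](permKV s') -[l0](permKV s'); apply: es'.
  by rewrite ltnW// (leq_trans A'l)// leqNgt.
(* Each label wrongly left out is charged 1, and the equality of counts moves the charge to the
   wrongly selected ones. *)
apply: (@le_trans _ _ (\sum_(l | A l && ~~ A' l) 1)).
  by apply: ler_sum => l _; case/andP: (e01 l).
rewrite cAA' [leLHS]big_mkcond [leRHS]big_mkcond/=; apply: ler_sum => l _.
have [AA'|_] := boolP (~~ A l && A' l); last first.
  by case: ifP => // _; rewrite addr_ge0.
rewrite (B2 _ AA') leqNgt; case/andP: AA' => -> _.
by rewrite lerDr.
Qed.

End ranking.

(** * Moments and peeling *)

Section decay.
Context {R : realType}.

(* The maximum with 1 caps the Markov bound, and avoids 0^-1 = 0 when the margin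
   vanishes. *)
Definition decay (p : nat) (v : R) : R := (Num.max 1 v) ^- p.

Lemma decay_ge0 p v : 0 <= decay p v.
Proof. by rewrite invr_ge0 exprn_ge0// le_max ler01. Qed.

Lemma decay_le1 p v : decay p v <= 1.
Proof. by rewrite invf_le1 ?exprn_gt0 ?lt_max ?ltr01// exprn_ege1// le_max lexx. Qed.

(** A pointwise Markov inequality: [m / v ^+ p] is at least 1. The summand 1 next to [m] covers
    [v <= 1], where [decay] equals 1. *)
Lemma decay_markov p v m : 0 <= m -> (1 <= v -> v ^+ p <= m) ->
  1 <= decay p v * (1 + m).
Proof.
move=> m0 vm; rewrite mulrC ler_pdivlMr ?exprn_gt0 ?lt_max ?ltr01// mul1r.
have [v1|v1] := leP v 1.
  by rewrite expr1n lerDl.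
by rewrite (le_trans (vm (ltW v1)))// lerDr.
Qed.

(* Bernoulli: the graph of the power is above its tangent at [v]. *)
Lemma expr_tangent p (u v : R) : 0 <= u -> 0 <= v ->
  v ^+ p + p%:R * v ^+ p.-1 * (u - v) <= u ^+ p.
Proof.
move=> u0 v0; elim: p => [|p IH]; first by rewrite !expr0 !mul0r addr0.
have H : 0 <= u * (u ^+ p - (v ^+ p + p%:R * v ^+ p.-1 * (u - v))).
  by rewrite mulr_ge0// subr_ge0.
have K : 0 <= p%:R * v ^+ p.-1 * (u - v) ^+ 2.
  by apply: mulr_ge0; [rewrite mulr_ge0// exprn_ge0|exact: sqr_ge0].
suff E : u ^+ p.+1 - (v ^+ p.+1 + p.+1%:R * v ^+ p * (u - v)) =
    u * (u ^+ p - (v ^+ p + p%:R * v ^+ p.-1 * (u - v))) +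
    p%:R * v ^+ p.-1 * (u - v) ^+ 2.
  by rewrite -subr_ge0 E addr_ge0.
case: p {IH H K} => [|p] /=; first by rewrite !expr0 !expr1; ring.
by rewrite !exprS -!natr1; ring.
Qed.

(** Jensen's inequality for the power: summing the tangent bounds at [v], the linear terms add up to
    something nonnegative because the mean of [u] reaches [v]. *)
Lemma decay_mean p (T : finType) (A : pred T) (u : T -> R) v :
  (0 < #|A|)%N -> (forall l, 0 <= u l) ->
  v * #|A|%:R <= \sum_(l | A l) u l ->
  1 <= decay p v * \sum_(l | A l) #|A|%:R^-1 * (1 + u l ^+ p).
Proof.
move=> A0 u0 vu; have A0' : 0 < #|A|%:R :> R by rewrite ltr0n.
rewrite -mulr_sumr big_split/= sumr_const mulrDr mulVf ?gt_eqF//.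
apply: decay_markov => [|v1].
  by rewrite mulr_ge0 ?invr_ge0 ?sumr_ge0// => l _; exact: exprn_ge0.
rewrite ler_pdivlMl//.
have v0 : 0 <= v by rewrite (le_trans ler01).
apply: (@le_trans _ _
    (\sum_(l | A l) (v ^+ p + p%:R * v ^+ p.-1 * (u l - v)))); last first.
  by apply: ler_sum => l _; exact: expr_tangent.
rewrite big_split/= -mulr_sumr sumrB !sumr_const [leLHS]mulr_natl lerDl.
by rewrite mulr_ge0 ?mulr_ge0 ?exprn_ge0// subr_ge0 -mulr_natr.
Qed.

End decay.

(** * Pointwise excess loss: wrong ranking and lost ranks *)

Section excess.
Context {R : realType} {L : nat}.
Implicit Types (e : 'I_L -> R) (s : {perm 'I_L}).

(* The quantity of the global margin condition. *)
Definition suffix_gap (beta : nat) e s (k i : nat) : R :=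
  i%:R^-1 *
  `|(\sum_(j < L | (k - i <= j < k)%N) (1 - e (s j))) - beta%:R|.

(* The outer sums have at most one term: [j] is the cutoff and [i] the rank just
   above the gap.  They are empty when all the labels are kept. *)
Definition swap_weight (beta : nat) (tau : R) p e s l : R :=
  \sum_(j < L | j == cutoff beta%:R e s :> nat)
    \sum_(i < L | j == i.+1 :> nat)
      decay p ((e (s i) - e (s j)) / (2 * tau)) * (e l + (j <= (s^-1)%g l)%N%:R).

Definition drop_weight (beta : nat) (tau : R) p e s l : R :=
  \sum_(i < L | (i < cutoff beta%:R e s)%N)
    decay p (suffix_gap beta e s (cutoff beta%:R e s) i.+1 / tau) *
    (if ((s^-1)%g l < i.+1)%N then i.+1%:R^-1 else 0).

(** Both sums use the true cutoff, so only the ranking matters. [swap_loss_le] charges the labels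
    whose error reaches half the gap, and [decay_markov] turns that event into a moment. *)
Lemma swap_excess_le beta tau p e e' s s' : 0 < tau -> (1 <= beta <= L)%N ->
  (forall l, 0 <= e l <= 1) -> sorts e s -> sorts e' s' ->
  \sum_(j < L | (j < cutoff beta%:R e s)%N) e (s j) -
  \sum_(j < L | (j < cutoff beta%:R e s)%N) e (s' j) <=
  \sum_l swap_weight beta tau p e s l * (1 + (`|e l - e' l| / tau) ^+ p).
Proof.
move=> tau0 bL e01 es es'.
have e0 l : 0 <= e l by case/andP: (e01 l).
have m0 l : 0 <= (`|e l - e' l| / tau) ^+ p.
  by rewrite exprn_ge0// divr_ge0// ltW.
set k := cutoff beta%:R e s.
have k1 : (1 <= k)%N.
  by apply: leq_trans (leq_beta_cutoff s e0 bL); case/andP: bL.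
(* If all the labels are kept, both rankings select the same set and there is no gap to look at. *)
have [kL|kL] := ltnP k L; last first.
  have {}kL : k = L by apply/eqP; rewrite eqn_leq kL cutoff_le_size.
  apply: (@le_trans _ _ 0); last first.
    apply: sumr_ge0 => l _; rewrite mulr_ge0// ?addr_ge0//.
    do 2!(apply: sumr_ge0 => ? _); rewrite mulr_ge0 ?decay_ge0//.
    by rewrite addr_ge0.
  rewrite !(sum_perm_rank e _ (fun j => j < k)%N) kL.
  by under eq_bigl do rewrite ltn_ord; under [X in _ - X]eq_bigl do
    rewrite ltn_ord; rewrite subrr.
have k1L : (k.-1 < L)%N by rewrite (leq_ltn_trans (leq_pred k)).
pose j := Ordinal kL; pose i := Ordinal k1L.
have ji : j = i.+1 :> nat by rewrite /= prednK.
have := swap_loss_le e01 es es' ji; rewrite -/k => /le_trans; apply.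
rewrite big_mkcond; apply: ler_sum => l _.
have E : swap_weight beta tau p e s l =
    decay p ((e (s i) - e (s j)) / (2 * tau)) * (e l + (j <= (s^-1)%g l)%N%:R).
  rewrite /swap_weight (big_pred1 j) => [|x]; last by rewrite /= -val_eqE.
  by rewrite (big_pred1 i)// => x; rewrite ji eqSS eq_sym /= -val_eqE.
have w0 : 0 <= e l + (j <= (s^-1)%g l)%N%:R by rewrite addr_ge0.
rewrite E; case: ifPn => [H|_]; last first.
  by rewrite !mulr_ge0 ?decay_ge0// addr_ge0.
rewrite mulrAC; apply: ler_peMl => //; apply: decay_markov => // v1.
rewrite lerXn2r ?nnegrE ?(le_trans _ v1)//.
  by rewrite divr_ge0// ltW.
by rewrite invfM mulrA ler_pM2r// invr_gt0.
Qed.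

(** Each rank [i] with [k' <= i < k] is charged 1. Losing it means that [i.+1] labels exceed the
    budget according to the estimates, although the suffix of [i.+1] labels ending at the true
    cutoff fits it; the error summed over the [i.+1] best labels makes up the difference. *)
Lemma drop_excess_le beta tau p e e' s s' : 0 < tau ->
  (forall l, 0 <= e l <= 1) -> (forall l, 0 <= e' l <= 1) ->
  sorts e s -> sorts e' s' ->
  \sum_(j < L | (j < cutoff beta%:R e s)%N) e (s' j) -
  \sum_(j < L | (j < cutoff beta%:R e' s')%N) e (s' j) <=
  \sum_l drop_weight beta tau p e s l * (1 + (`|e l - e' l| / tau) ^+ p).
Proof.
move=> tau0 e01 e'01 es es'.
have e0 l : 0 <= e l by case/andP: (e01 l).
set k := cutoff beta%:R e s; set k' := cutoff beta%:R e' s'.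
have m0 l : 0 <= (`|e l - e' l| / tau) ^+ p.
  by rewrite exprn_ge0// divr_ge0// ltW.
apply: (@le_trans _ _ (\sum_(j < L | (j < k)%N) (k' <= j)%N%:R)).
  rewrite lerBlDr (bigID (fun j : 'I_L => j < k')%N)/= addrC lerD//.
    rewrite big_mkcond [leRHS]big_mkcond/=; apply: ler_sum => j _.
    rewrite -leqNgt; case: ifP => [/andP[-> ->]|_]; last by case: ifP.
    by case/andP: (e01 (s' j)).
  rewrite big_mkcond [leRHS]big_mkcond/=; apply: ler_sum => j _.
  by case: ifP => [/andP[_ ->]//|_]; case: ifP.
rewrite /drop_weight -/k.
under [leRHS]eq_bigr do rewrite mulr_suml.
rewrite exchange_big/=; apply: ler_sum => i ik.
have w0 l : 0 <= (if ((s^-1)%g l < i.+1)%N then i.+1%:R^-1 else 0 : R).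
  by case: ifP.
have [k'i|_] := leqP k' i; last first.
  by apply: sumr_ge0 => l _; rewrite !mulr_ge0 ?decay_ge0// addr_ge0.
pose A : pred 'I_L := fun l => ((s^-1)%g l < i.+1)%N.
have cA : #|A| = i.+1.
  exact: etrans (card_perm_rank s (fun j => j < i.+1)%N) (card_ord_lt (ltn_ord i)).
set v := suffix_gap _ _ _ _ _ / _.
have : v * #|A|%:R <= \sum_(l | A l) `|e l - e' l| / tau.
  rewrite cA /v /suffix_gap mulrAC [_%:R^-1 * _]mulrC divfK ?pnatr_eq0//.
  rewrite -mulr_suml ler_pM2r ?invr_gt0//.
  (* The suffix is part of the [k] best labels, which fit the budget: the signed quantity is
     nonpositive. *)
  rewrite ler0_norm; last first.
    rewrite subr_le0; apply: le_trans (@cutoff_sum _ _ beta%:R e s (ler0n _ _)).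
    rewrite -/k big_mkcond [leRHS]big_mkcond/=; apply: ler_sum => j _.
    case: ifP => [/andP[_ ->]//|_]; case: ifP => // _.
    by rewrite subr_ge0; case/andP: (e01 (s j)).
  (* Otherwise [i.+1] would be an admissible rank for the estimates, against [k' <= i]. *)
  have H1 : beta%:R < \sum_(j < L | (j < i.+1)%N) (1 - e' (s' j)).
    rewrite ltNge; apply/negP => H.
    by have := leq_cutoff (ltn_ord i : 0 < i.+1 <= L)%N H; rewrite -/k' ltnNge k'i.
  have H2 : \sum_(l | A l) e' l <= \sum_(j < L | (j < i.+1)%N) e' (s' j).
    exact: sum_le_top.
  have H3 : \sum_(j < L | (k - i.+1 <= j < k)%N) e (s j) <=
            \sum_(j < L | (j < i.+1)%N) e (s j).
    rewrite (sum_perm_rank e s (fun j => k - i.+1 <= j < k)%N).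
    apply: sum_le_top => //.
    apply: etrans (card_perm_rank s (fun j => k - i.+1 <= j < k)%N) _.
    by rewrite [LHS]card_ord_itv ?cutoff_le_size// subKn.
  have H4 : \sum_(l | A l) e l = \sum_(j < L | (j < i.+1)%N) e (s j).
    by rewrite (sum_perm_rank e s (fun j => j < i.+1)%N).
  have H5 : \sum_(l | A l) (e l - e' l) <= \sum_(l | A l) `|e l - e' l|.
    by apply: ler_sum => l _; exact: ler_norm.
  apply: le_trans H5; move: H1; rewrite !sumrB.
  have -> : \sum_(j < L | (k - i.+1 <= j < k)%N) 1 = i.+1%:R :> R.
    rewrite sumr_const; congr (1 *+ _); rewrite [LHS]card_ord_itv ?subKn//.
    exact: cutoff_le_size.
  by rewrite sum1_ord_lt//; lra.
move/(decay_mean p); rewrite cA => /(_ isT) H.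
apply: le_trans (H _) _ => [l|]; first by rewrite divr_ge0// ltW.
rewrite mulr_sumr big_mkcond/=; apply: ler_sum => l _.
by rewrite /A; case: ifP => _; rewrite ?mulrA// mulr0 mul0r.
Qed.

(** The difference of losses is a difference of selected scores. It is split at an intermediate
    selection: the estimated ranking with the true cutoff. *)
Lemma excess_le beta tau p e e' s s' : 0 < tau -> (1 <= beta <= L)%N ->
  (forall l, 0 <= e l <= 1) -> (forall l, 0 <= e' l <= 1) ->
  sorts e s -> sorts e' s' ->
  \sum_(l | ~~ tnth (plug_in beta%:R e' s') l) e l <=
  \sum_(l | ~~ tnth (plug_in beta%:R e s) l) e l +
  \sum_l (swap_weight beta tau p e s l + drop_weight beta tau p e s l) *
         (1 + (`|e l - e' l| / tau) ^+ p).
Proof.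
move=> tau0 bL e01 e'01 es es'.
have H1 := swap_excess_le p tau0 bL e01 es es'.
have H2 := drop_excess_le beta p tau0 e01 e'01 es es'.
under [X in _ <= _ + X]eq_bigr do rewrite mulrDl.
rewrite big_split/=.
have E (f : 'I_L -> R) t : \sum_l e l =
    \sum_(l < L | (l < cutoff beta%:R f t)%N) e (t l) +
    \sum_(l | ~~ tnth (plug_in beta%:R f t) l) e l.
  rewrite (bigID (fun l => tnth (plug_in beta%:R f t) l))/=; congr (_ + _).
  rewrite (sum_perm_rank e t (fun j => j < cutoff beta%:R f t)%N).
  by apply: eq_bigl => l; exact: tnth_plug_in.
by have := E e' s'; rewrite (E e s); lra.
Qed.

(** The scores contribute at most [S]; the labels ranked from the cutoff on number at most
    [L - beta]. Sparsity also confines the cutoff to the window of the outer sum. *)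
Lemma swap_weight_sum (beta S : nat) tau p e s : (forall l, 0 <= e l) ->
  (1 <= beta <= L)%N -> \sum_l e l <= S%:R ->
  \sum_l swap_weight beta tau p e s l <=
  (S + (L - beta))%N%:R * \sum_(j < L | (beta <= j <= beta + S)%N)
   \sum_(i < L | j == i.+1 :> nat)
     (j == cutoff beta%:R e s :> nat)%:R * decay p ((e (s i) - e (s j)) / (2 * tau)).
Proof.
move=> e0 bL eS; rewrite /swap_weight exchange_big/= mulr_sumr.
rewrite big_mkcond [leRHS]big_mkcond/=; apply: ler_sum => j _.
case: eqP => [jk|_]; last first.
  by case: ifP => // _; rewrite big1 ?mulr0// => i _; rewrite mul0r.
rewrite jk leq_beta_cutoff// cutoff_leq_sparse//= exchange_big mulr_sumr/=.
apply: ler_sum => i _; rewrite -mulr_sumr mulrC mul1r.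
apply: ler_wpM2r; first exact: decay_ge0.
rewrite big_split/= natrD; apply: lerD => //.
rewrite (reindex_inj (@perm_inj _ s))/=.
under eq_bigr do rewrite permK.
rewrite -natr_sum ler_nat -big_mkcond/=.
have kb := leq_beta_cutoff s e0 bL.
apply: (@leq_trans (L - cutoff beta%:R e s)); last exact: leq_sub2l.
rewrite -(card_ord_itv (cutoff beta%:R e s) (leqnn L)) -sum1_card.
rewrite leq_eqVlt; apply/orP; left; apply/eqP; apply: eq_bigl => l.
by rewrite inE ltn_ord andbT.
Qed.

Lemma drop_weight_sum (beta : nat) tau p e s :
  \sum_l drop_weight beta tau p e s l =
  \sum_(i < L | (i < cutoff beta%:R e s)%N)
    decay p (suffix_gap beta e s (cutoff beta%:R e s) i.+1 / tau).
Proof.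
rewrite /drop_weight exchange_big/=; apply: eq_bigr => i _.
rewrite -mulr_sumr -[RHS]mulr1; congr (_ * _).
rewrite -big_mkcond -(sum_perm_rank (fun=> _) s (fun j => j < i.+1)%N).
under eq_bigr do rewrite -[_^-1]mulr1.
by rewrite -mulr_sumr sum1_ord_lt// mulVf// pnatr_eq0.
Qed.

End excess.

(** * Integration of nonnegative real functions *)

Lemma measurable_le_set {d} {T : measurableType d} {R : realType} (f g : T -> R) :
  measurable_fun setT f -> measurable_fun setT g ->
  measurable [set x | f x <= g x].
Proof.
move=> mf mg; rewrite -[X in measurable X]setTI.
exact: (measurable_fun_ler mf mg measurableT (Y := [set true])).
Qed.

Section ge0_real_integral.
Context {d : measure_display} {T : measurableType d} {R : realType}.
Variable mu : {measure set T -> \bar R}.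
Implicit Types F G : T -> R.

Lemma ge0_integralD_EFin F G :
  measurable_fun setT F -> measurable_fun setT G ->
  (forall x, 0 <= F x) -> (forall x, 0 <= G x) ->
  (\int[mu]_x (F x + G x)%:E = \int[mu]_x (F x)%:E + \int[mu]_x (G x)%:E)%E.
Proof.
move=> mF mG F0 G0; under eq_integral do rewrite EFinD.
by rewrite ge0_integralD//; [move=> x _; rewrite lee_fin|exact/measurable_EFinP|
  move=> x _; rewrite lee_fin|exact/measurable_EFinP].
Qed.

Lemma ge0_integralZ_EFin F k : measurable_fun setT F ->
  (forall x, 0 <= F x) -> 0 <= k ->
  (\int[mu]_x (k * F x)%:E = k%:E * \int[mu]_x (F x)%:E)%E.
Proof.
move=> mF F0 k0; under eq_integral do rewrite EFinM.
by rewrite ge0_integralZl_EFin//; [move=> x _; rewrite lee_fin|exact/measurable_EFinP].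
Qed.

Lemma measurable_sum_cond (I : Type) (r : seq I) (P : pred I) (F : I -> T -> R) :
  (forall i, P i -> measurable_fun setT (F i)) ->
  measurable_fun setT (fun x => \sum_(i <- r | P i) F i x).
Proof.
move=> mF; elim: r => [|i r IH].
  by under eq_fun do rewrite big_nil; exact: measurable_cst.
under eq_fun do rewrite big_cons.
by case Pi : (P i) => //; apply: measurable_funD => //; exact: mF.
Qed.

Lemma ge0_integral_sum_EFin (I : Type) (r : seq I) (P : pred I) (F : I -> T -> R) :
  (forall i, P i -> measurable_fun setT (F i)) ->
  (forall i x, P i -> 0 <= F i x) ->
  (\int[mu]_x (\sum_(i <- r | P i) F i x)%:E =
   \sum_(i <- r | P i) \int[mu]_x (F i x)%:E)%E.
Proof.
move=> mF F0; elim: r => [|i r IH].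
  by rewrite big_nil; under eq_integral do rewrite big_nil; rewrite integral0.
rewrite big_cons; under eq_integral do rewrite big_cons.
case Pi : (P i) => //; rewrite ge0_integralD_EFin ?IH//.
- exact: mF.
- by apply: measurable_sum_cond.
- by move=> x; exact: F0.
- by move=> x; apply: sumr_ge0 => j; exact: F0.
Qed.

Lemma ae_ge0_le_integral_EFin F G :
  measurable_fun setT F -> measurable_fun setT G ->
  (forall x, 0 <= F x) -> (forall x, 0 <= G x) ->
  {ae mu, forall x, F x <= G x} ->
  (\int[mu]_x (F x)%:E <= \int[mu]_x (G x)%:E)%E.
Proof.
move=> mF mG F0 G0 FG; apply: ae_ge0_le_integral => //.
- by move=> x _; rewrite lee_fin.
- exact/measurable_EFinP.
- by move=> x _; rewrite lee_fin.
- exact/measurable_EFinP.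
- by apply: filterS FG => x + _; rewrite lee_fin.
Qed.

End ge0_real_integral.

(** * Dyadic sums for moments and margins *)

Lemma dyadic_series_le2 {R : realType} n : \sum_(j < n) 2^-1 ^+ j <= 2 :> R.
Proof.
suff -> : \sum_(j < n) 2^-1 ^+ j = 2 - 2 * 2^-1 ^+ n :> R.
  by rewrite gerBl mulr_ge0// exprn_ge0.
elim: n => [|n IH]; first by rewrite big_ord0 expr0; lra.
by rewrite big_ord_recr/= IH exprS; lra.
Qed.

(** The exponential dominates the degree [n] term of its series; take inverses. *)
Lemma expRN_le {R : realType} (x : R) n : 0 < x ->
  expR (- x) <= n`!%:R / x ^+ n.
Proof.
move=> x0; rewrite expRN -[leRHS]invrK lef_pV2 ?posrE ?expR_gt0//; last first.
  by rewrite invr_gt0 divr_gt0 ?exprn_gt0// ltr0n fact_gt0.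
rewrite invf_div; case: n => [|n].
  by rewrite expr0 fact0 divr1 -expR0 ler_expR ltW.
by apply: le_trans (expR_ge1Dxn n (ltW x0)); rewrite lerDr.
Qed.

(** Bounded functions have finitely many dyadic levels, so the decompositions below are finite
    sums. *)
Lemma pow2_bound {R : realType} (b : R) : exists J, b <= 2 ^+ J.
Proof.
exists (Num.bound `|b|); apply: (le_trans (ler_norm _)).
have /ltW/le_trans := archi_boundP (normr_ge0 b); apply.
by rewrite -natrX ler_nat ltnW// ltn_expl.
Qed.

Section moment.
Context {d : measure_display} {T : measurableType d} {R : realType}.
Variable Q : probability T R.

(** If [u > 1], the largest [j] with [2 ^+ j < u] gives a term [2 ^+ (p * j.+1)] that already
    dominates; the leading 1 covers [u <= 1]. *)
Lemma dyadic_moment p (u : R) J : 0 <= u -> u <= 2 ^+ J ->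
  u ^+ p <= 1 + \sum_(j < J) 2 ^+ (p * j.+1) * (2 ^+ j <= u)%R%:R.
Proof.
move=> u0; elim: J => [|J IH] uJ.
  by rewrite big_ord0 addr0 exprn_ile1// -(expr0 2).
rewrite big_ord_recr/= addrA.
have [uJ'|uJ'] := leP u (2 ^+ J).
  by apply: le_trans (IH uJ') _; rewrite lerDl mulr_ge0// exprn_ge0.
rewrite (ltW uJ') mulr1; apply: (@le_trans _ _ (2 ^+ (p * J.+1))).
  by rewrite mulnC exprM lerXn2r// nnegrE// exprn_ge0.
by rewrite lerDr addr_ge0// sumr_ge0// => j _; rewrite mulr_ge0// exprn_ge0.
Qed.

(** At level [j] the tail is at most a multiple of [(4 ^+ j) ^- p], which beats the weight
    [2 ^+ (p * j.+1)] and leaves a geometric series. The bound [b] fixes the number of levels but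
    does not enter the constant. *)
Lemma moment_le p (C1 C2 b : R) (u : T -> R) : (0 < p)%N -> 0 < C1 -> 0 < C2 ->
  measurable_fun setT u -> (forall t, 0 <= u t <= b) ->
  (forall j : nat, Q [set t | (2 ^+ j <= u t)%R] <= (C1 * expR (- (C2 * 4 ^+ j)))%:E)%E ->
  (\int[Q]_t (1 + u t ^+ p)%:E <=
   (2 + 2 ^+ p.+1 * C1 * p`!%:R / C2 ^+ p)%:E)%E.
Proof.
move=> p0 C10 C20 mu ub tail.
have [J bJ] := pow2_bound b.
pose A j := [set t | 2 ^+ j <= u t].
have mA j : measurable (A j).
  exact: measurable_le_set.
apply: (@le_trans _ _ (\int[Q]_t (2 + \sum_(j < J) 2 ^+ (p * j.+1) * \1_(A j) t)%:E)%E).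
  apply: ae_ge0_le_integral_EFin.
  - by apply: measurable_funD => //; exact: measurable_funX.
  - apply: measurable_funD => //; apply: measurable_sum => j.
    by apply: measurable_funM => //; exact: measurable_indic.
  - by move=> t; rewrite addr_ge0// exprn_ge0//; case/andP: (ub t).
  - by move=> t; rewrite addr_ge0// sumr_ge0// => j _; rewrite mulr_ge0// exprn_ge0.
  apply: aeW => t; case/andP: (ub t) => u0 ub'.
  have := dyadic_moment p u0 (le_trans ub' bJ).
  rewrite (_ : \sum_(j < J) _ = \sum_(j < J) 2 ^+ (p * j.+1) * \1_(A j) t)%R.
    by lra.
  apply: eq_bigr => j _; rewrite indicE; congr (_ * (nat_of_bool _)%:R).
  by apply/idP/idP => [H|]; [apply/mem_set|move/set_mem].
rewrite ge0_integralD_EFin//; last 2 first.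
- apply: measurable_sum => j.
  by apply: measurable_funM => //; exact: measurable_indic.
- by move=> t; rewrite sumr_ge0// => j _; rewrite mulr_ge0// exprn_ge0.
rewrite integral_cst// [X in (_ * X)%E](_ : _ = 1%E); last exact: probability_setT.
rewrite mule1.
rewrite ge0_integral_sum_EFin; last 2 first.
- by move=> j _; apply: measurable_funM => //; exact: measurable_indic.
- by move=> j x _; rewrite mulr_ge0// exprn_ge0.
pose K : R := 2 ^+ p * C1 * p`!%:R / C2 ^+ p.
have K0 : 0 <= K.
  by rewrite !mulr_ge0 ?exprn_ge0 ?invr_ge0 ?exprn_ge0// ltW.
rewrite [leRHS]EFinD leeD2l//.
apply: (@le_trans _ _ (\sum_(j < J) (K * 2^-1 ^+ j)%:E)%E).
  apply: lee_sum => j _; rewrite ge0_integralZ_EFin ?exprn_ge0//.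
  rewrite integral_indic// setIT.
  apply: (@le_trans _ _ ((2 ^+ (p * j.+1))%:E *
                         (C1 * expR (- (C2 * 4 ^+ j)))%:E)%E).
    by apply: lee_wpmul2l; [rewrite lee_fin exprn_ge0|exact: tail].
  rewrite -EFinM lee_fin.
  apply: (@le_trans _ _ (2 ^+ (p * j.+1) * (C1 * (p`!%:R / (C2 * 4 ^+ j) ^+ p)))).
    apply: ler_wpM2l; first exact: exprn_ge0.
    apply: ler_wpM2l; first exact: ltW.
    by apply: expRN_le; rewrite mulr_gt0 ?exprn_gt0.
  have -> : 2 ^+ (p * j.+1) * (C1 * (p`!%:R / (C2 * 4 ^+ j) ^+ p)) =
      K * (2^-1 ^+ j) ^+ p :> R.
    set y : R := 2 ^+ (p * j).
    have y0 : y != 0 by rewrite gt_eqF// exprn_gt0.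
    have E4 : (4 ^+ j) ^+ p = y * y.
      by rewrite -exprM mulnC (_ : 4 = 2 * 2 :> R) ?exprMn//; lra.
    have E2 : (2^-1 ^+ j) ^+ p = y^-1 by rewrite -exprM mulnC exprVn.
    rewrite /K mulnS exprD exprMn E4 E2 -/y.
    have : C2 ^+ p != 0 by rewrite gt_eqF// exprn_gt0.
    move: (C2 ^+ p) (2 ^+ p) => a1 a2 a10; field.
    by rewrite y0.
  (* Here [0 < p] makes the [p]-th power of [2^-1 ^+ j] at most [2^-1 ^+ j]. *)
  rewrite ler_wpM2l// ler_iXnr// ?exprn_ge0//.
  by rewrite exprn_ile1// invf_le1// ler1n.
rewrite sumEFin lee_fin -mulr_sumr.
apply: (@le_trans _ _ (K * 2)); first by rewrite ler_wpM2l// dyadic_series_le2.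
by rewrite /K exprS mulrC !mulrA.
Qed.

Lemma measurable_decay p : measurable_fun setT (@decay R p).
Proof.
apply: nonincreasing_measurable => // x y xy.
rewrite /decay lef_pV2 ?posrE ?exprn_gt0 ?lt_max ?ltr01//.
have m0 (z : R) : Num.max 1 z \is Num.nneg by rewrite nnegrE le_max ler01.
by rewrite lerXn2r// ge_max !le_max lexx xy orbT.
Qed.

(** On the shell where [W / tau] is about [2 ^+ j], [decay] is of order [2^-1 ^+ (p * j)] and the
    margin condition costs the factor [2 ^+ j] to the power [alpha]. As [alpha + 1 <= p], a
    geometric series remains. *)
Lemma peeling p (alpha c tau b : R) (B : set T) (W : T -> R) :
  0 < tau -> 0 <= c -> alpha + 1 <= p%:R ->
  measurable_fun setT W -> measurable B -> (forall x, W x <= b) ->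
  (forall delta : R, 0 < delta ->
     (Q [set x | (W x <= delta)%R /\ B x] <= (c * delta `^ alpha)%:E)%E) ->
  (\int[Q]_x (\1_B x * decay p (W x / tau))%:E <=
   (2 ^+ p.+1 * (c * tau `^ alpha))%:E)%E.
Proof.
move=> tau0 c0 ap mW mB Wb margin.
have [J bJ] := pow2_bound (b / tau).
pose A j := [set x | W x <= 2 ^+ j * tau /\ B x].
have mA j : measurable (A j).
  by apply: measurableI => //; exact: measurable_le_set.
have pointwise (v : R) n : v <= 2 ^+ n ->
    decay p v <= \sum_(j < n.+1) 2 ^+ p * 2^-1 ^+ (p * j) * (v <= 2 ^+ j)%R%:R.
  elim: n => [|n IH] vn.
    rewrite big_ord_recl big_ord0 addr0 /= vn muln0 expr0 !mulr1.
    by rewrite (le_trans (decay_le1 _ _))// exprn_ege1// ler1n.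
  rewrite big_ord_recr/=; have [vn'|vn'] := leP v (2 ^+ n).
    by apply: (le_trans (IH vn')); rewrite lerDl !mulr_ge0 ?exprn_ge0// invr_ge0.
  rewrite vn mulr1; apply: (@le_trans _ _ (2 ^+ p * 2^-1 ^+ (p * n.+1))).
    rewrite mulnC exprM -exprMn exprSr mulrCA divff ?mulr1 ?pnatr_eq0// exprVn.
    rewrite /decay exprVn lef_pV2 ?posrE ?exprn_gt0 ?lt_max ?ltr01//.
    by rewrite lerXn2r ?nnegrE ?exprn_ge0 ?le_max ?ler01 ?(ltW vn') ?orbT.
  by rewrite lerDr sumr_ge0// => j _; rewrite !mulr_ge0 ?exprn_ge0 ?invr_ge0.
apply: (@le_trans _ _
  (\int[Q]_x (\sum_(j < J.+1) 2 ^+ p * 2^-1 ^+ (p * j) * \1_(A j) x)%:E)%E).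
  apply: ae_ge0_le_integral_EFin.
  - apply: measurable_funM; first exact: measurable_indic.
    apply: (measurableT_comp (measurable_decay p)).
    by apply: measurable_funM.
  - apply: measurable_sum_cond => j _.
    by apply: measurable_funM => //; exact: measurable_indic.
  - by move=> x; rewrite mulr_ge0// decay_ge0.
  - move=> x; apply: sumr_ge0 => j _.
    by rewrite !mulr_ge0 ?exprn_ge0 ?invr_ge0.
  apply: aeW => x; have [Bx|nBx] := pselect (B x); last first.
    rewrite indicE memNset// mul0r; apply: sumr_ge0 => j _.
    by rewrite !mulr_ge0 ?exprn_ge0 ?invr_ge0.
  rewrite indicE mem_set// mul1r.
  have vJ : W x / tau <= 2 ^+ J.
    by rewrite (le_trans _ bJ)// ler_pM2r ?invr_gt0.
  apply: (le_trans (pointwise _ _ vJ)); apply: ler_sum => j _.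
  apply: ler_wpM2l; first by rewrite mulr_ge0 ?exprn_ge0.
  rewrite ler_pdivrMr// indicE.
  by have [Wj|_] := boolP (W x <= _); [rewrite mem_set|rewrite ler0n].
rewrite ge0_integral_sum_EFin; last 2 first.
- by move=> j _; apply: measurable_funM => //; exact: measurable_indic.
- by move=> j x _; rewrite !mulr_ge0 ?exprn_ge0 ?invr_ge0.
apply: (@le_trans _ _
    (\sum_(j < J.+1) (2 ^+ p * (c * tau `^ alpha) * 2^-1 ^+ j)%:E)%E).
  apply: lee_sum => j _.
  rewrite ge0_integralZ_EFin ?mulr_ge0 ?exprn_ge0 ?invr_ge0//.
  rewrite integral_indic// setIT.
  have y1 : 1 <= 2 ^+ j :> R by rewrite exprn_ege1// ler1n.
  have y0 : 0 < 2 ^+ j :> R by rewrite exprn_gt0.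
  apply: (@le_trans _ _ ((2 ^+ p * 2^-1 ^+ (p * j))%:E *
                         (c * (2 ^+ j * tau) `^ alpha)%:E)%E).
    apply: lee_wpmul2l; first by rewrite lee_fin mulr_ge0 ?exprn_ge0.
    by apply: margin; rewrite mulr_gt0.
  rewrite -EFinM lee_fin powRM ?(ltW y0) ?(ltW tau0)//.
  rewrite -!mulrA ler_wpM2l ?exprn_ge0// mulrCA ler_wpM2l//.
  rewrite mulrA [leRHS]mulrC ler_wpM2r ?powR_ge0//.
  rewrite mulnC exprM !exprVn ler_pdivrMl ?exprn_gt0// ler_pdivlMr//.
  (* It remains that [y] to the power [alpha + 1] is at most [y ^+ p], for [y >= 1]. *)
  move: (2 ^+ j) y0 y1 => y y0 y1.
  rewrite -powR_mulrn ?(ltW y0)// -[X in _ * X]powRr1 ?(ltW y0)//.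
  by rewrite -powRD ?(gt_eqF y0) ?implybT// ler_powR.
rewrite sumEFin lee_fin -mulr_sumr exprS -mulrA [leRHS]mulrC.
apply: ler_wpM2l; last exact: dyadic_series_le2.
by rewrite !mulr_ge0 ?exprn_ge0 ?powR_ge0.
Qed.

End moment.

(** * Measurability of the plug-in classifier *)

Section measurable_ranking.
Context {d : measure_display} {T : measurableType d} {R : realType} {L : nat}.
Implicit Types (e : T -> 'I_L -> R) (s : T -> {perm 'I_L}).

(** Splitting over the finitely many values of [s] reduces measurability to fixed rankings. *)
Lemma measurable_perm_set s (A : {perm 'I_L} -> set T) :
  measurable_perm s -> (forall p, measurable (A p)) ->
  measurable [set t | A (s t) t].
Proof.
move=> ms mA; rewrite (_ : [set t | _] =
    \bigcup_(p in [set: {perm 'I_L}]) ([set t | s t = p] `&` A p)).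
  by apply: fin_bigcup_measurable => [|p _]; [exact: finite_finset|exact: measurableI].
by apply/seteqP; split=> [t At|t [p _ [<-]]//]; exists (s t).
Qed.

Lemma measurable_perm_fun s (F : {perm 'I_L} -> T -> R) :
  measurable_perm s -> (forall p, measurable_fun setT (F p)) ->
  measurable_fun setT (fun t => F (s t) t).
Proof.
move=> ms mF _ Y mY; rewrite setTI.
apply: (measurable_perm_set (A := fun p => F p @^-1` Y)) => // p.
by rewrite -[X in measurable X]setTI; exact: mF.
Qed.

Lemma measurable_lt_cutoff (b : R) e (p : {perm 'I_L}) i :
  (forall l, measurable_fun setT (e ^~ l)) ->
  measurable [set t | (i < cutoff b (e t) p)%N].
Proof.
move=> me; rewrite (_ : [set t | _] =
    \bigcup_(m in [set m : 'I_L.+1 | (i < m)%N /\ (0 < m)%N])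
      [set t | \sum_(j < L | (j < m)%N) (1 - e t (p j)) <= b]).
  apply: fin_bigcup_measurable => [|m _]; first exact: finite_finset.
  apply: measurable_le_set => //.
  apply: measurable_sum_cond => j _; apply: measurable_funB => //.
apply/seteqP; split=> [t /lt_cutoffP[m [im m0 mb]]|t [m [im m0] mb]].
  by exists m.
by apply/lt_cutoffP; exists m.
Qed.

Lemma measurable_eq_cutoff (b : R) e s k :
  (forall l, measurable_fun setT (e ^~ l)) -> measurable_perm s ->
  measurable [set t | cutoff b (e t) (s t) = k].
Proof.
move=> me ms.
apply: (measurable_perm_set (A := fun p => [set t | cutoff b (e t) p = k])) => // p.
have mlt i : measurable [set t | (i < cutoff b (e t) p)%N].
  exact: measurable_lt_cutoff.
case: k => [|k].
  rewrite (_ : [set t | _] = ~` [set t | (0 < cutoff b (e t) p)%N]).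
    exact: measurableC.
  apply/seteqP; split=> t /=; first by move=> ->.
  by rewrite lt0n => /negP; rewrite negbK => /eqP.
rewrite (_ : [set t | _] = [set t | (k < cutoff b (e t) p)%N] `\`
                           [set t | (k.+1 < cutoff b (e t) p)%N]).
  exact: measurableD.
apply/seteqP; split=> t /=; first by move=> ->; rewrite ltnn ltnSn.
by move=> [kc /negP]; rewrite -leqNgt => ck; apply/eqP; rewrite eqn_leq ck.
Qed.

Lemma measurable_plug_in (b : R) e s l v :
  (forall l, measurable_fun setT (e ^~ l)) -> measurable_perm s ->
  measurable [set t | tnth (plug_in b (e t) (s t)) l = v].
Proof.
move=> me ms; apply: (measurable_perm_set
  (A := fun p => [set t | tnth (plug_in b (e t) p) l = v])) => // p.
have mlt : measurable [set t | tnth (plug_in b (e t) p) l].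
  under eq_set do rewrite tnth_plug_in.
  exact: measurable_lt_cutoff.
case: v => //; rewrite (_ : [set t | _] = ~` [set t | tnth (plug_in b (e t) p) l]).
  exact: measurableC.
apply/seteqP; split=> t /=; first by move=> ->.
by move/negP/negbTE.
Qed.

Lemma measurable_rank e s i :
  (forall l, measurable_fun setT (e ^~ l)) -> measurable_perm s ->
  measurable_fun setT (fun t => e t (s t i)).
Proof.
move=> me ms.
exact: (measurable_perm_fun (F := fun p t => e t (p i))).
Qed.

End measurable_ranking.

(** * Conditional probabilities *)

Section regression.
Context {d : measure_display} {X : measurableType d} {R : realType} {L : nat}.
Variables (P : probability (X * L.-tuple bool)%type R) (eta : X -> 'I_L -> R).
Implicit Types f : X -> L.-tuple bool.
Hypothesis reg : is_regression P eta.

Local Notation mu := (marginal P).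

Lemma measurable_label l v :
  measurable [set z : X * L.-tuple bool | tnth z.2 l = v].
Proof.
rewrite -[X in measurable X]setTI.
have := measurableT_comp (measurable_tnth l) (@measurable_snd _ _ X (L.-tuple bool)).
by move=> /(_ measurableT [set v]); exact.
Qed.

Lemma marginalE A : mu A = P (fst @^-1` A).
Proof. by []. Qed.

Lemma measurable_regression l : measurable_fun setT (eta ^~ l).
Proof.
by have [/measurable_int mi _] := reg.2 l; apply/measurable_EFinP.
Qed.

(** Lets the explicit versions built from [eta] replace the unspecified ones of
    [cond_prob_sum_le]. *)
Lemma is_cond_prob_ae_eq (E : set (X * L.-tuple bool)) (g g' : X -> R) :
  is_cond_prob P E g -> is_cond_prob P E g' -> {ae mu, forall x, g x = g' x}.
Proof.
move=> [ig Eg] [ig' Eg'].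
have : ae_eq mu setT (EFin \o g) (EFin \o g').
  apply: integral_ae_eq => //; first exact: measurable_int ig'.
  by move=> A _ mA; rewrite -Eg// -Eg'.
by apply: filterS => x /(_ I) /= [].
Qed.

(** Given the features, [f] is known and a false positive has probability [1 - eta x l] where [f]
    selects [l]. The proof passes to the complementary event, on which [eta] is the given
    version. *)
Lemma is_cond_prob_false_positive f l : measurable [set x | tnth (f x) l = true] ->
  is_cond_prob P [set z | tnth (f z.1) l = true /\ tnth z.2 l = false]
    (fun x => (tnth (f x) l)%:R * (1 - eta x l)).
Proof.
set B := [set x | _] => mB.
have me := measurable_regression l.
have fE x : (tnth (f x) l)%:R * (1 - eta x l) = \1_B x * (1 - eta x l) :> R.
  rewrite indicE; case fx : (tnth (f x) l); first by rewrite mem_set.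
  by rewrite memNset//= /B /= fx.
have mg : measurable_fun setT (fun x => \1_B x * (1 - eta x l)).
  apply: measurable_funM; first exact: measurable_indic.
  by apply: measurable_funB.
rewrite (_ : (fun x => _) = (fun x => \1_B x * (1 - eta x l))); last exact/funext.
have e01 x : 0 <= eta x l <= 1 by exact: reg.1.
split.
  apply: (@le_integrable _ _ _ mu _ measurableT _ (cst 1%E)) => //.
  - exact/measurable_EFinP.
  - move=> x _ /=; rewrite lee_fin ger0_norm.
      rewrite normr1 indicE; case: (_ \in _); rewrite ?mul0r// mul1r gerBl.
      by case/andP: (e01 x).
    by rewrite mulr_ge0// subr_ge0; case/andP: (e01 x).
  - exact: finite_measure_integrable_cst.
move=> A mA.
have mAB : measurable (A `&` B) by exact: measurableI.
have intE : (\int[mu]_(x in A) (\1_B x * (1 - eta x l))%:E =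
             \int[mu]_(x in A `&` B) (1 - eta x l)%:E)%E.
  rewrite integral_mkcondr; apply: eq_integral => x _.
  by rewrite patchE indicE; case: (_ \in _); rewrite ?mul1r ?mul0r.
have H1 : (\int[mu]_(x in A `&` B) (1 - eta x l)%:E +
           \int[mu]_(x in A `&` B) (eta x l)%:E = mu (A `&` B))%E.
  rewrite -ge0_integralD//=.
  - under eq_integral do rewrite -EFinD subrK.
    by rewrite integral_cst// mul1e.
  - by move=> x _; rewrite lee_fin subr_ge0; case/andP: (e01 x).
  - by apply/measurable_EFinP/measurable_funB => //; exact: measurable_funTS.
  - by move=> x _; rewrite lee_fin; case/andP: (e01 x).
  - by apply/measurable_EFinP; exact: measurable_funTS.
have mfst : measurable (fst @^-1` (A `&` B) : set (X * L.-tuple bool)).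
  by rewrite -[X in measurable X]setTI; exact: measurable_fst.
(* Where [f] selects [l], the label is either positive or a false positive. *)
have H2 : (P (fst @^-1` (A `&` B)) =
    P ([set z | tnth z.2 l = true] `&` fst @^-1` (A `&` B)) +
    P ([set z | tnth (f z.1) l = true /\ tnth z.2 l = false] `&` fst @^-1` A))%E.
  rewrite -measureU//.
  - congr (P _); apply/seteqP; split=> [[x y]/= [Ax Bx]|[x y] /=].
      by case yl : (tnth y l); [left|right].
    by move=> [[_ []]//|[[]]].
  - by apply: measurableI => //; exact: measurable_label.
  - rewrite (_ : _ `&` _ = [set z | tnth z.2 l = false] `&` fst @^-1` (A `&` B)).
      by apply: measurableI => //; exact: measurable_label.
    by apply/seteqP; split=> [[x y]/= [[? ?] ?]|[x y]/= [? [? ?]]].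
  - by apply/seteqP; split=> // -[x y] /= [[yl _] [[_]]]; rewrite yl.
have etaE : (P ([set z | tnth z.2 l = true] `&` fst @^-1` (A `&` B)) =
    \int[mu]_(x in A `&` B) (eta x l)%:E)%E by exact: (reg.2 l).2.
have mY : measurable ([set z | tnth z.2 l = true] `&`
                      fst @^-1` (A `&` B) : set (X * L.-tuple bool)).
  by apply: measurableI => //; exact: measurable_label.
rewrite intE; move: H1; rewrite marginalE H2 -etaE => /(congr1 (fun a =>
  a - P ([set z | tnth z.2 l = true] `&` fst @^-1` (A `&` B)))%E).
by rewrite [X in _ = (X - _)%E -> _]addeC !addeK ?fin_num_measure// => <-.
Qed.

(** Integrating [eta] over the region where [f] leaves out [l] gives the [l]-th term; the risk
    becomes an average of pointwise losses, which can be compared at each [x]. *)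
Lemma riskE f : (forall l, measurable [set x | tnth (f x) l = false]) ->
  (risk P f)%:E =
  (\int[mu]_x (L%:R^-1 * \sum_(l | ~~ tnth (f x) l) eta x l)%:E)%E.
Proof.
move=> mf.
have e0 x l : 0 <= eta x l by case/andP: (reg.1 x l).
have mfe l : measurable_fun setT
    (fun x => \1_[set x | tnth (f x) l = false] x * eta x l).
  by apply: measurable_funM; [exact: measurable_indic|exact: measurable_regression].
under eq_integral => x _.
  rewrite (_ : \sum_(l | _) eta x l =
    \sum_l \1_[set x | tnth (f x) l = false] x * eta x l); last first.
    rewrite big_mkcond; apply: eq_bigr => l _; rewrite indicE.
    case fx : (tnth (f x) l); first by rewrite memNset ?mul0r//= fx.
    by rewrite mem_set ?mul1r.
  over.
rewrite ge0_integralZ_EFin//; last 2 first.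
- exact: measurable_sum_cond.
- by move=> x; apply: sumr_ge0 => l _; rewrite mulr_ge0.
rewrite ge0_integral_sum_EFin//; last by move=> l x _; rewrite mulr_ge0.
rewrite /risk EFinM -sumEFin; congr (_ * _)%E; apply: eq_bigr => l _.
rewrite fineK; last first.
  rewrite fin_num_measure//.
  apply: measurableI; last exact: measurable_label.
  rewrite -[X in measurable X]setTI.
  exact: (@measurable_fst _ _ X (L.-tuple bool) measurableT _ (mf l)).
rewrite (_ : [set z | _] = [set z | tnth z.2 l = true] `&`
   fst @^-1` [set x | tnth (f x) l = false]); last first.
  by apply/seteqP; split=> [z []|z []].
rewrite (reg.2 l).2// [LHS]integral_mkcond; apply: eq_integral => x _.
by rewrite patchE indicE; case: (_ \in _); rewrite ?mul1r ?mul0r.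
Qed.

Lemma controlled_ae f (beta : R) : controlled_classifier P beta f ->
  {ae mu, forall x, \sum_(l | tnth (f x) l) (1 - eta x l) <= beta}.
Proof.
move=> [mf [g [gP gb]]].
have mfl l : measurable [set x | tnth (f x) l = true].
  rewrite -[X in measurable X]setTI.
  have := measurableT_comp (measurable_tnth l) mf.
  by move=> /(_ measurableT [set true]); exact.
have : {ae mu, forall x, forall l, g l x = (tnth (f x) l)%:R * (1 - eta x l)}.
  apply: filter_forall => l; apply: (is_cond_prob_ae_eq (gP l)).
  exact: is_cond_prob_false_positive.
move: gb; apply: filterS2 => x gb gE.
rewrite big_mkcond; apply: le_trans gb; apply: ler_sum => l _.
by rewrite gE; case: (tnth _ _); rewrite ?mul1r ?mul0r.
Qed.

Lemma sparse_ae (c : R) :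
  cond_prob_sum_le P (fun l => [set z | tnth z.2 l = true]) c ->
  {ae mu, forall x, \sum_l eta x l <= c}.
Proof.
move=> [g [gP gc]].
have : {ae mu, forall x, forall l, g l x = eta x l}.
  apply: filter_forall => l; apply: (is_cond_prob_ae_eq (gP l)).
  exact: reg.2.
move: gc; apply: filterS2 => x gc gE.
by apply: le_trans gc; apply: ler_sum => l _; rewrite gE.
Qed.

End regression.

(** The window has [minn (L - beta) S.+1] elements. The first bound is used against the factor [S],
    and the second, at most [2 * S], against [L - beta]. *)
Lemma card_rank_window (L beta S : nat) : (beta <= L)%N -> (0 < S)%N ->
  ((S + (L - beta)) * #|[pred j : 'I_L | (beta <= j <= beta + S)%N]| <=
   3 * (S * (L - beta)))%N.
Proof.
move=> bL S0; set c := #|_|.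
have -> : c = (minn L (beta + S.+1) - beta)%N.
  rewrite -(card_ord_itv _ (geq_minl _ _)); apply: eq_card => j.
  by rewrite !inE leq_min ltn_ord /= addnS ltnS.
have c1 : (minn L (beta + S.+1) - beta <= L - beta)%N by lia.
have c2 : (minn L (beta + S.+1) - beta <= 2 * S)%N by lia.
rewrite mulnDl (_ : 3 * _ = S * (L - beta) + (L - beta) * (2 * S))%N; last by ring.
by rewrite leq_add// leq_mul.
Qed.

(** * Integrating the weights against the margin conditions *)

Section weight_integral.
Context {d : measure_display} {X : measurableType d} {R : realType} {L : nat}.
Variables (mu : probability X R) (eta : X -> 'I_L -> R).
Variables (sigma : X -> {perm 'I_L}) (beta S : nat).
Hypothesis eta01 : forall x l, 0 <= eta x l <= 1.
Hypothesis meta : forall l, measurable_fun setT (eta ^~ l).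
Hypothesis msigma : measurable_perm sigma.
Hypothesis bL : (1 <= beta <= L)%N.

Let K x := cutoff beta%:R (eta x) (sigma x).

(** The random cutoff is spread over its deterministic values by indicators, so that each term meets
    one margin condition. *)
Definition swap_level (tau : R) p x : R :=
  \sum_(j < L | (beta <= j <= beta + S)%N) \sum_(i < L | j == i.+1 :> nat)
    \1_[set x | K x = j] x *
    decay p ((eta x (sigma x i) - eta x (sigma x j)) / (2 * tau)).

(** Here [k] runs up to [L] included: ranks can be lost even when the oracle keeps every label. *)
Definition drop_level (tau : R) p x : R :=
  \sum_(k < L.+1 | (beta <= k)%N) \sum_(i < L | (i < k)%N)
    \1_[set x | K x = k] x *
    decay p (suffix_gap beta (eta x) (sigma x) k i.+1 / tau).

Lemma measurable_suffix_gap k i :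
  measurable_fun setT (fun x => suffix_gap beta (eta x) (sigma x) k i).
Proof.
apply: measurable_funM => //; apply: measurableT_comp => //.
apply: measurable_funB => //; apply: measurable_sum_cond => j _.
by apply: measurable_funB => //; exact: measurable_rank.
Qed.

Lemma measurable_swap_term (tau : R) p (i j : 'I_L) : measurable_fun setT
  (fun x => \1_[set x | K x = j] x *
    decay p ((eta x (sigma x i) - eta x (sigma x j)) / (2 * tau))).
Proof.
apply: measurable_funM; first exact/measurable_indic/measurable_eq_cutoff.
apply: (measurableT_comp (measurable_decay p)).
by apply: measurable_funM => //; apply: measurable_funB; exact: measurable_rank.
Qed.

Lemma measurable_drop_term (tau : R) p (k i : nat) : measurable_fun setT
  (fun x => \1_[set x | K x = k] x *
    decay p (suffix_gap beta (eta x) (sigma x) k i / tau)).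
Proof.
apply: measurable_funM; first exact/measurable_indic/measurable_eq_cutoff.
apply: (measurableT_comp (measurable_decay p)).
by apply: measurable_funM => //; exact: measurable_suffix_gap.
Qed.

Lemma indic_decay_ge0 (B : set X) p v x : 0 <= \1_B x * decay p v :> R.
Proof. by rewrite mulr_ge0// decay_ge0. Qed.

Lemma measurable_swap_level tau p : measurable_fun setT (swap_level tau p).
Proof.
by do 2![apply: measurable_sum_cond => ? _]; exact: measurable_swap_term.
Qed.

Lemma measurable_drop_level tau p : measurable_fun setT (drop_level tau p).
Proof.
by do 2![apply: measurable_sum_cond => ? _]; exact: measurable_drop_term.
Qed.

Lemma swap_level_ge0 tau p x : 0 <= swap_level tau p x.
Proof. by do 2![apply: sumr_ge0 => ? _]; exact: indic_decay_ge0. Qed.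

Lemma drop_level_ge0 tau p x : 0 <= drop_level tau p x.
Proof. by do 2![apply: sumr_ge0 => ? _]; exact: indic_decay_ge0. Qed.

Lemma indic_cutoff k x : \1_[set x | K x = k] x = (k == K x)%:R :> R.
Proof.
rewrite indicE; case: eqP => [->|kK]; first by rewrite mem_set.
by rewrite memNset//= => /esym.
Qed.

Lemma weight_sum_le tau p x : \sum_l eta x l <= S%:R ->
  \sum_l (swap_weight beta tau p (eta x) (sigma x) l +
          drop_weight beta tau p (eta x) (sigma x) l) <=
  (S + (L - beta))%N%:R * swap_level tau p x + drop_level tau p x.
Proof.
move=> etaS; have e0 l : 0 <= eta x l by case/andP: (eta01 x l).
rewrite big_split/=; apply: lerD.
  apply: (le_trans (swap_weight_sum tau p (sigma x) e0 bL etaS)).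
  apply: ler_wpM2l => //; do 2![apply: ler_sum => ? _].
  by rewrite indic_cutoff.
rewrite drop_weight_sum /drop_level.
have KL : (K x < L.+1)%N by rewrite ltnS cutoff_le_size.
rewrite (bigD1 (Ordinal KL)) ?leq_beta_cutoff//=.
rewrite -[leLHS]addr0 lerD//.
  by apply: ler_sum => i _; rewrite indic_cutoff eqxx mul1r.
by do 2![apply: sumr_ge0 => ? _]; exact: indic_decay_ge0.
Qed.

(** One peeling for each cutoff in the window, at scale [2 * tau] because half the gap is compared
    with the error; [card_rank_window] then counts the cutoffs. *)
Lemma swap_level_integral (C0 alpha tau : R) p :
  0 < C0 -> 0 < alpha -> 0 < tau -> alpha + 1 <= p%:R -> (0 < S)%N ->
  (forall (i j : 'I_L) (delta : R), j = i.+1 :> nat -> 0 < delta ->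
    (mu [set x | (eta x (sigma x i) - eta x (sigma x j) <= delta)%R /\ K x = j]
     <= (C0 * delta `^ alpha)%:E)%E) ->
  (\int[mu]_x ((S + (L - beta))%N%:R * swap_level tau p x)%:E <=
   (3 * (S%:R * (L%:R - beta%:R)) * (2 ^+ p.+1 * (C0 * (2 * tau) `^ alpha)))%:E)%E.
Proof.
move=> C00 a0 tau0 ap S0 margin.
set c := 2 ^+ p.+1 * _.
have c0 : 0 <= c by rewrite !mulr_ge0 ?exprn_ge0 ?powR_ge0 ?(ltW C00).
rewrite ge0_integralZ_EFin//; [|exact: measurable_swap_level|exact: swap_level_ge0].
apply: (@le_trans _ _ ((S + (L - beta))%N%:R%:E *
    (\sum_(j < L | (beta <= j <= beta + S)%N) c)%:E)%E).
  apply: lee_wpmul2l; first by rewrite lee_fin.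
  rewrite /swap_level ge0_integral_sum_EFin; last 2 first.
  - by move=> j _; apply: measurable_sum_cond => i _; exact: measurable_swap_term.
  - by move=> j x _; apply: sumr_ge0 => i _; exact: indic_decay_ge0.
  rewrite -sumEFin; apply: lee_sum => j _.
  rewrite ge0_integral_sum_EFin; last 2 first.
  - by move=> i _; exact: measurable_swap_term.
  - by move=> i x _; exact: indic_decay_ge0.
  apply: (@le_trans _ _ (\sum_(i < L | j == i.+1 :> nat) c%:E)%E).
    apply: lee_sum => i /eqP ji.
    apply: (@peeling _ _ _ mu p alpha C0 (2 * tau) 1 [set x | K x = j]
      (fun x => eta x (sigma x i) - eta x (sigma x j))) => //.
    - by rewrite mulr_gt0.
    - exact: ltW.
    - by apply: measurable_funB; exact: measurable_rank.
    - exact: measurable_eq_cutoff.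
    - move=> x; case/andP: (eta01 x (sigma x i)) => _; apply: le_trans.
      by rewrite gerBl; case/andP: (eta01 x (sigma x j)).
    - by move=> delta; exact: margin.
  (* The inner sum contains only the predecessor of [j], and is empty for [j = 0]. *)
  have [j0|j0] := posnP (nat_of_ord j).
    by rewrite big_pred0 ?lee_fin// => i; rewrite j0.
  have jL : (j.-1 < L)%N by rewrite (leq_ltn_trans (leq_pred j)).
  rewrite (big_pred1 (Ordinal jL)) => [//|i /=].
  by rewrite -[X in X == _]prednK// eqSS eq_sym -val_eqE.
rewrite -EFinM lee_fin sumr_const -[X in _ * X <= _]mulr_natr mulrCA -natrM.
rewrite [leRHS]mulrC.
apply: ler_wpM2l => //; rewrite -natrB; last by case/andP: bL.
rewrite -!natrM ler_nat; apply: card_rank_window => //.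
by case/andP: bL.
Qed.

(** One peeling for each pair of a cutoff and a lost rank; the summability of [h] keeps the total
    proportional to [L - beta]. *)
Lemma drop_level_integral (Ch alpha tau : R) p (h : R -> R) :
  0 < alpha -> 0 < tau -> alpha + 1 <= p%:R -> (forall t, 0 <= t -> 0 <= h t) ->
  \sum_(beta <= k < L.+1) \sum_(1 <= l < L.+1) h `|k%:R - l%:R|
    <= Ch * (L%:R - beta%:R) ->
  (forall (k l : nat) (delta : R), (beta <= k <= L)%N -> (1 <= l <= k)%N ->
    0 < delta ->
    (mu [set x | (suffix_gap beta (eta x) (sigma x) k l <= delta)%R /\ K x = k]
     <= (beta%:R `^ alpha * delta `^ alpha * h `|k%:R - l%:R|)%:E)%E) ->
  (\int[mu]_x (drop_level tau p x)%:E <=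
   (2 ^+ p.+1 * (beta%:R `^ alpha * tau `^ alpha * (Ch * (L%:R - beta%:R))))%:E)%E.
Proof.
move=> a0 tau0 ap h0 hCh margin.
rewrite /drop_level ge0_integral_sum_EFin; last 2 first.
- by move=> k _; apply: measurable_sum_cond => i _; exact: measurable_drop_term.
- by move=> k x _; apply: sumr_ge0 => i _; exact: indic_decay_ge0.
set c := 2 ^+ p.+1 * (beta%:R `^ alpha * tau `^ alpha).
have c0 : 0 <= c by rewrite !mulr_ge0 ?exprn_ge0 ?powR_ge0.
apply: (@le_trans _ _ (\sum_(k < L.+1 | (beta <= k)%N) \sum_(i < L | (i < k)%N)
    (c * h `|k%:R - i.+1%:R|)%:E)%E).
  apply: lee_sum => k bk; rewrite ge0_integral_sum_EFin; last 2 first.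
  - by move=> i _; exact: measurable_drop_term.
  - by move=> i x _; exact: indic_decay_ge0.
  apply: lee_sum => i ik.
  rewrite (_ : c * _ = 2 ^+ p.+1 *
    (beta%:R `^ alpha * h `|k%:R - i.+1%:R| * tau `^ alpha)); last by rewrite /c; ring.
  apply: (@peeling _ _ _ mu p alpha _ tau (L%:R + beta%:R) [set x | K x = k]
      (fun x => suffix_gap beta (eta x) (sigma x) k i.+1)) => //.
  - by rewrite mulr_ge0 ?powR_ge0// h0.
  - exact: measurable_suffix_gap.
  - exact: measurable_eq_cutoff.
  - move=> x; rewrite /suffix_gap ler_pdivrMl ?ltr0n//.
    apply: (@le_trans _ _ (L%:R + beta%:R)); last first.
      by rewrite ler_peMl ?addr_ge0// ler1n.
    apply: (le_trans (ler_normB _ _)); rewrite [`|beta%:R|]ger0_norm// lerD2r.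
    apply: (le_trans (ler_norm_sum _ _ _)).
    apply: (@le_trans _ _ (\sum_(j < L) 1)); last by rewrite sumr_const card_ord.
    rewrite big_mkcond; apply: ler_sum => j _; case: ifP => // _.
    case/andP: (eta01 x (sigma x j)) => e0 e1.
    by rewrite ger0_norm ?subr_ge0// gerBl.
  - move=> delta delta0; rewrite mulrAC; apply: margin => //.
    by rewrite bk -ltnS ltn_ord.
under eq_bigr do rewrite sumEFin.
rewrite sumEFin lee_fin.
under eq_bigr do rewrite -mulr_sumr.
rewrite -mulr_sumr mulrA ler_wpM2l//; apply: le_trans hCh.
(* With [l = i.+1], the lost ranks are extended to all [l] up to [L], since [h] is nonnegative. *)
rewrite big_geq_mkord; apply: ler_sum => k _.
rewrite big_add1 big_mkord big_mkcond; apply: ler_sum => i _.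
by case: ifP => // _; exact: h0.
Qed.

End weight_integral.

(** * Expected excess risk *)

Section expected_risk.
Context {d dO : measure_display} {X : measurableType d} {O : measurableType dO}.
Context {R : realType} {L : nat}.
Variables (P : probability (X * L.-tuple bool)%type R) (Q : probability O R).
Variables (eta : X -> 'I_L -> R) (sigma : X -> {perm 'I_L}).
Variables (etahat : O -> X -> 'I_L -> R) (sigmahat : O -> X -> {perm 'I_L}).
Variables (beta S p : nat) (tau M : R).
Hypothesis reg : is_regression P eta.
Hypothesis msigma : measurable_perm sigma.
Hypothesis ssigma : forall x, sorts (eta x) (sigma x).
Hypothesis metahat : forall l,
  measurable_fun setT (fun z : O * X => etahat z.1 z.2 l).
Hypothesis etahat01 : forall o x l, 0 <= etahat o x l <= 1.
Hypothesis msigmahat : measurable_perm (fun z : O * X => sigmahat z.1 z.2).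
Hypothesis ssigmahat : forall o x, sorts (etahat o x) (sigmahat o x).
Hypothesis bL : (1 <= beta <= L)%N.
Hypothesis tau0 : 0 < tau.
Hypothesis M0 : 0 <= M.

Local Notation mu := (marginal P).
Let fhat o x := plug_in beta%:R (etahat o x) (sigmahat o x).
Let fopt x := plug_in beta%:R (eta x) (sigma x).

Let loss (f : L.-tuple bool) x := L%:R^-1 * \sum_(l | ~~ tnth f l) eta x l.

Let eta0 x l : 0 <= eta x l.
Proof. by case/andP: (reg.1 x l). Qed.

Let loss_ge0 f x : 0 <= loss f x.
Proof. by rewrite mulr_ge0 ?invr_ge0// sumr_ge0. Qed.

Lemma measurable_loss d' (T : measurableType d') (f : T -> L.-tuple bool)
    (g : T -> X) :
  (forall l, measurable [set t | tnth (f t) l = false]) -> measurable_fun setT g ->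
  measurable_fun setT (fun t => loss (f t) (g t)).
Proof.
move=> mf mg; apply: measurable_funM => //.
under eq_fun do rewrite big_mkcond.
rewrite (_ : (fun x => _) = fun x =>
    \sum_l \1_[set t | tnth (f t) l = false] x * eta (g x) l); last first.
  apply/funext => x; apply: eq_bigr => l _; rewrite indicE.
  case fx : (tnth (f x) l); first by rewrite memNset ?mul0r//= fx.
  by rewrite mem_set ?mul1r.
apply: measurable_sum => l; apply: measurable_funM; first exact: measurable_indic.
exact: (measurableT_comp (measurable_regression reg l) mg).
Qed.

Let mfhat l : measurable [set z : O * X | tnth (fhat z.1 z.2) l = false].
Proof. exact: (measurable_plug_in _ _ _ metahat msigmahat). Qed.

Let metahat_section x l : measurable_fun setT (fun o => etahat o x l).
Proof. exact: (measurableT_comp (metahat l) (pair2_measurable x)). Qed.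

Let msigmahat_section1 o : measurable_perm (sigmahat o).
Proof.
move=> q; rewrite -[X in measurable X]setTI.
exact: (@pair1_measurable _ _ O X o measurableT _ (msigmahat q)).
Qed.

Let mloss_hat : measurable_fun setT (fun z : O * X => loss (fhat z.1 z.2) z.2).
Proof. by apply: measurable_loss. Qed.

(** At a fixed [x] the weights do not depend on the sample, so the expectation falls on the errors
    alone, each with moment at most [M]. *)
Lemma conditional_loss_le x : \sum_l eta x l <= S%:R ->
  (forall l, (\int[Q]_o (1 + (`|eta x l - etahat o x l| / tau) ^+ p)%:E <= M%:E)%E) ->
  (\int[Q]_o (loss (fhat o x) x)%:E <=
   (loss (fopt x) x + L%:R^-1 * (M *
     ((S + (L - beta))%N%:R * swap_level eta sigma beta S tau p x +
      drop_level eta sigma beta tau p x)))%:E)%E.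
Proof.
move=> etaS moment.
pose w l := swap_weight beta tau p (eta x) (sigma x) l +
            drop_weight beta tau p (eta x) (sigma x) l.
pose u o l : R := 1 + (`|eta x l - etahat o x l| / tau) ^+ p.
have u0 o l : 0 <= u o l.
  by rewrite addr_ge0// exprn_ge0// divr_ge0// ltW.
have mu_ l : measurable_fun setT (u ^~ l).
  apply: measurable_funD => //; apply: measurable_funX.
  apply: measurable_funM => //; apply: measurableT_comp => //.
  by apply: measurable_funB.
have w0 l : 0 <= w l.
  apply: addr_ge0; do ?[apply: sumr_ge0 => ? _].
    by rewrite mulr_ge0 ?decay_ge0// addr_ge0.
  by rewrite mulr_ge0 ?decay_ge0//; case: ifP.
apply: (@le_trans _ _
    (\int[Q]_o (loss (fopt x) x + L%:R^-1 * \sum_l w l * u o l)%:E)%E).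
  apply: ae_ge0_le_integral_EFin.
  - exact: (measurableT_comp mloss_hat (pair2_measurable x)).
  - apply: measurable_funD => //; apply: measurable_funM => //.
    by apply: measurable_sum => l; apply: measurable_funM.
  - by move=> o; exact: loss_ge0.
  - move=> o; rewrite addr_ge0 ?loss_ge0// mulr_ge0 ?invr_ge0// sumr_ge0// => l _.
    by rewrite mulr_ge0.
  apply: aeW => o; rewrite -mulrDr ler_wpM2l ?invr_ge0//.
  exact: (excess_le p tau0 bL (reg.1 x) (etahat01 o x) (ssigma x) (ssigmahat o x)).
have mwu l : measurable_fun setT (fun o => w l * u o l).
  by apply: measurable_funM.
have wu0 o : 0 <= \sum_l w l * u o l.
  by rewrite sumr_ge0// => l _; rewrite mulr_ge0.
rewrite ge0_integralD_EFin//; last 2 first.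
- by apply: measurable_funM => //; exact: measurable_sum.
- by move=> o; rewrite mulr_ge0 ?invr_ge0.
rewrite integral_cst// [X in (_ * X + _)%E](_ : _ = 1%E); last exact: probability_setT.
rewrite mule1 EFinD leeD2l//.
rewrite ge0_integralZ_EFin ?invr_ge0//; last exact: measurable_sum.
rewrite EFinM lee_wpmul2l ?lee_fin ?invr_ge0//.
rewrite ge0_integral_sum_EFin//; last by move=> l o _; rewrite mulr_ge0.
apply: (@le_trans _ _ (\sum_l (w l * M)%:E)%E).
  apply: lee_sum => l _; rewrite ge0_integralZ_EFin// EFinM.
  by apply: lee_wpmul2l; [rewrite lee_fin|exact: moment].
rewrite sumEFin lee_fin -mulr_suml mulrC ler_wpM2l//.
exact: (weight_sum_le sigma reg.1 bL).
Qed.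

(** Tonelli's theorem puts the sample average inside the integral over [x], where the error moments
    are controlled at almost every [x]; the oracle loss is then compared with that of [fstar]
    pointwise. *)
Lemma expected_risk_le fstar (B1 B2 : R) :
  controlled_classifier P beta%:R fstar ->
  {ae mu, forall x, \sum_l eta x l <= S%:R} ->
  {ae mu, forall x, forall l,
    (\int[Q]_o (1 + (`|eta x l - etahat o x l| / tau) ^+ p)%:E <= M%:E)%E} ->
  (\int[mu]_x ((S + (L - beta))%N%:R * swap_level eta sigma beta S tau p x)%:E
    <= B1%:E)%E ->
  (\int[mu]_x (drop_level eta sigma beta tau p x)%:E <= B2%:E)%E ->
  ('E_Q[fun o => risk P (fhat o)] <=
   (risk P fstar + L%:R^-1 * (M * (B1 + B2)))%:E)%E.
Proof.
move=> cstar sparse moment HB1 HB2.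
have mfstar l : measurable [set x | tnth (fstar x) l = false].
  rewrite -[X in measurable X]setTI.
  by have := measurableT_comp (measurable_tnth l) cstar.1;
    move=> /(_ measurableT [set false]); exact.
have meta := measurable_regression reg.
rewrite unlock.
have riskhat o : (risk P (fhat o))%:E = (\int[mu]_x (loss (fhat o x) x)%:E)%E.
  apply: (riskE reg) => l; apply: measurable_plug_in => // l'.
  exact: (measurableT_comp (metahat l') (@pair1_measurable _ _ O X o)).
under eq_integral do rewrite riskhat.
have mH : measurable_fun setT (fun z : O * X => (loss (fhat z.1 z.2) z.2)%:E).
  exact/measurable_EFinP.
rewrite (@fubini_tonelli _ _ _ _ _ Q mu
  (fun z : O * X => (loss (fhat z.1 z.2) z.2)%:E) mH) /=; last first.
  by move=> z; rewrite lee_fin.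
have mswap : measurable_fun setT (swap_level eta sigma beta S tau p).
  exact: measurable_swap_level.
have mdrop : measurable_fun setT (drop_level eta sigma beta tau p).
  exact: measurable_drop_level.
pose G x : R := (S + (L - beta))%N%:R * swap_level eta sigma beta S tau p x +
      drop_level eta sigma beta tau p x.
have mswap' : measurable_fun setT
    (fun x => (S + (L - beta))%N%:R * swap_level eta sigma beta S tau p x).
  exact: measurable_funM.
have mG : measurable_fun setT G by exact: measurable_funD.
have s0 x : 0 <= (S + (L - beta))%N%:R * swap_level eta sigma beta S tau p x.
  by rewrite mulr_ge0// swap_level_ge0.
have G0 x : 0 <= G x by rewrite addr_ge0// drop_level_ge0.
have mlossstar : measurable_fun setT (fun x => loss (fstar x) x).
  exact: measurable_loss.
apply: (@le_trans _ _
    (\int[mu]_x (loss (fstar x) x + L%:R^-1 * (M * G x))%:E)%E).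
  apply: ae_ge0_le_integral => //.
  - by move=> x _; apply: integral_ge0 => o _; rewrite lee_fin.
  - by apply: (@measurable_fun_fubini_tonelli_G _ _ _ _ _ Q _ mH) => z; rewrite lee_fin.
  - by move=> x _; rewrite lee_fin addr_ge0// !mulr_ge0 ?invr_ge0.
  - apply/measurable_EFinP/measurable_funD => //.
    by do 2![apply: measurable_funM => //].
  near=> x => _.
  apply: le_trans (conditional_loss_le _ _) _.
  - by near: x.
  - by move=> l; move: l; near: x.
  rewrite lee_fin lerD2r ler_wpM2l ?invr_ge0//.
  apply: (@oracle_loss_le _ _ beta%:R (eta x) (sigma x) (fun l => tnth (fstar x) l)) => //.
  by near: x; exact: controlled_ae.
rewrite ge0_integralD_EFin//; last 2 first.
- by do 2![apply: measurable_funM => //].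
- by move=> x; rewrite !mulr_ge0 ?invr_ge0.
rewrite [leRHS]EFinD leeD//; first by rewrite (riskE reg).
rewrite ge0_integralZ_EFin ?invr_ge0//; last 2 first.
- exact: measurable_funM.
- by move=> x; rewrite mulr_ge0.
rewrite ge0_integralZ_EFin// ge0_integralD_EFin//; last first.
  by move=> x; exact: drop_level_ge0.
rewrite !EFinM lee_wpmul2l ?lee_fin ?invr_ge0//.
rewrite lee_wpmul2l ?lee_fin// EFinD.
exact: leeD.
Unshelve. all: by end_near.
Qed.

End expected_risk.

Theorem theorem4p9 (R : realType) (C0 C1 C2 alpha1 alpha2 Ch : R) :
  0 < C0 -> 0 < C1 -> 0 < C2 -> 0 < alpha1 -> 0 < alpha2 -> 0 < Ch ->
  exists2 Ct : R, 0 < Ct &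
  forall (gamma : R) (D L beta S : nat)
    (P : probability (D.-tuple R * L.-tuple bool)%type R)
    (eta : D.-tuple R -> 'I_L -> R)
    (sigma : D.-tuple R -> {perm 'I_L})
    (etahat : forall N : nat, N.-tuple (D.-tuple R * L.-tuple bool)%type ->
       D.-tuple R -> 'I_L -> R)
    (sigmahat : forall N : nat, N.-tuple (D.-tuple R * L.-tuple bool)%type ->
       D.-tuple R -> {perm 'I_L})
    (h : R -> R),
  let K x := cutoff beta%:R (eta x) (sigma x) in
  0 < gamma ->
  (2 <= L)%N -> (1 <= beta <= L)%N -> (0 < S < L)%N ->
  is_regression P eta ->
  measurable_perm sigma ->
  (forall x, sorts (eta x) (sigma x)) ->
  (forall N, (1 <= N)%N ->
    [/\ forall l, measurable_fun setT
          (fun z : N.-tuple (D.-tuple R * L.-tuple bool)%type * D.-tuple R =>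
             etahat N z.1 z.2 l),
        forall data x l, 0 <= etahat N data x l <= 1,
        measurable_perm
          (fun z : N.-tuple (D.-tuple R * L.-tuple bool)%type * D.-tuple R =>
             sigmahat N z.1 z.2)
      & forall data x, sorts (etahat N data x) (sigmahat N data x)]) ->
  (* exponential bound *)
  (forall N, (1 <= N)%N -> forall (delta : R) (l : 'I_L), 0 < delta ->
    {ae marginal P, forall x,
      (product_law P N
         [set data | (delta <= `|eta x l - etahat N data x l|)%R]
       <= (C1 * expR (- (C2 * N%:R `^ gamma * delta ^+ 2)))%:E)%E}) ->
  (* local margin; the pair (i, k) stands for the 1-based indices (k, k + 1) *)
  (forall (i k : 'I_L) (delta : R), k = i.+1 :> nat -> 0 < delta ->
    (marginal P [set x | (eta x (sigma x i) - eta x (sigma x k) <= delta)%R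
                         /\ K x = k]
     <= (C0 * delta `^ alpha1)%:E)%E) ->
  (* sparsity *)
  cond_prob_sum_le P (fun l => [set z | tnth z.2 l = true]) S%:R ->
  (* global margin *)
  (forall t, 0 <= t -> 0 <= h t) ->
  h 0 = 1 ->
  \sum_(beta <= k < L.+1) \sum_(1 <= l < L.+1) h `|k%:R - l%:R|
    <= Ch * (L%:R - beta%:R) ->
  (forall (k l : nat) (delta : R), (beta <= k <= L)%N -> (1 <= l <= k)%N ->
    0 < delta ->
    (marginal P
       [set x | (l%:R^-1 *
                 `|(\sum_(j < L | (k - l <= j < k)%N) (1 - eta x (sigma x j)))
                   - beta%:R| <= delta)%R
                /\ K x = k]
     <= (beta%:R `^ alpha2 * delta `^ alpha2 * h `|k%:R - l%:R|)%:E)%E) ->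
  forall (N : nat) (fstar : D.-tuple R -> L.-tuple bool), (1 <= N)%N ->
  risk_argmin P (controlled_classifier P beta%:R) fstar ->
  ('E_(product_law P N)[fun data =>
      risk P (fun x => plug_in beta%:R (etahat N data x) (sigmahat N data x))]
   - (risk P fstar)%:E
   <= (Ct * (beta%:R `^ alpha2 + S%:R) * ((L%:R - beta%:R) / L%:R)
       * N%:R `^ (- (gamma * Num.min alpha2 alpha1 / 2)))%:E)%E.
Proof.
move=> C00 C10 C20 a10 a20 Ch0.
(* One exponent large enough for [peeling] under both margin conditions. *)
pose p := (Num.bound (alpha1 + alpha2)).+1.
have pa : alpha1 + alpha2 + 1 <= p%:R.
  by rewrite /p -natr1 lerD2r ltW// archi_boundP// addr_ge0// ltW.
have p1 : alpha1 + 1 <= p%:R by lra.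
have p2 : alpha2 + 1 <= p%:R by lra.
pose M := 2 + 2 ^+ p.+1 * C1 * p`!%:R / C2 ^+ p.
have M0 : 0 < M.
  have f0 : 0 < p`!%:R :> R by rewrite ltr0n fact_gt0.
  by apply: addr_gt0 => //; rewrite divr_gt0 ?exprn_gt0// mulr_gt0// mulr_gt0// exprn_gt0.
pose c : R := 2 ^+ p.+1.
have c0 : 0 < c by rewrite exprn_gt0.
have b0 : 0 < 2 `^ alpha1 :> R by rewrite powR_gt0.
(* [M] bounds the moments and [c] comes from peeling; 3 counts cutoffs, and the power of 2 reflects
   the scale [2 * tau] of the gap. *)
exists (M * c * (3 * (C0 * 2 `^ alpha1) + Ch)).
  apply: mulr_gt0; first exact: mulr_gt0.
  by apply: addr_gt0 => //; do 2![apply: mulr_gt0 => //].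
move=> gamma D L beta S P eta sigma etahat sigmahat h K gamma0 L2 bL S0 reg
  msigma ssigma hat expo local_margin sparse h0 h1 hCh global_margin N fstar N1
  [cstar _].
have [metahat etahat01 msigmahat ssigmahat] := hat N N1.
(* The scale at which the exponent of the tail bound no longer depends on [N]. *)
pose tau : R := N%:R `^ (- (gamma / 2)).
have N0 : 0 < N%:R :> R by rewrite ltr0n.
have tau0 : 0 < tau by rewrite powR_gt0.
have tau1 : tau <= 1.
  rewrite /tau powRN invf_le1 ?powR_gt0// -[leLHS](powRr0 N%:R).
  by apply: ler_powR; rewrite ?ler1n// ltW// divr_gt0.
have tauN : N%:R `^ gamma * tau ^+ 2 = 1.
  rewrite -powR_mulrn ?(ltW tau0)// -powRrM -powRD; last first.
    by rewrite (gt_eqF N0) implybT.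
  by rewrite (_ : gamma + _ = 0) ?powRr0//; field.
have tail : {ae marginal P, forall x, forall l, forall j : nat,
    (product_law P N [set data | (2 ^+ j * tau <= `|eta x l - etahat N data x l|)%R]
     <= (C1 * expR (- (C2 * 4 ^+ j)))%:E)%E}.
  (* Only countably many deviations [2 ^+ j * tau] are used, so a single null set serves all of
     them. *)
  apply: filter_forall => l; apply: ae_foralln => j.
  have tj : 0 < 2 ^+ j * tau by rewrite mulr_gt0// exprn_gt0.
  move: (expo N N1 _ l tj); apply: filterS => x /le_trans; apply.
  rewrite lee_fin; have -> // : C2 * N%:R `^ gamma * (2 ^+ j * tau) ^+ 2 =
    C2 * 4 ^+ j.
  have -> : 4 = 2 ^+ 2 :> R by ring.
  by rewrite exprMn -mulrA [_ `^ _ * _]mulrCA tauN mulr1 -!exprM mulnC.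
have moment : {ae marginal P, forall x, forall l,
    (\int[product_law P N]_o
       (1 + (`|eta x l - etahat N o x l| / tau) ^+ p)%:E <= M%:E)%E}.
  apply: filterS tail => x tail l.
  apply: (@moment_le _ _ _ _ p C1 C2 tau^-1
    (fun o => `|eta x l - etahat N o x l| / tau)) => //.
  - apply: measurable_funM => //; apply: measurableT_comp => //.
    apply: measurable_funB => //.
    exact: (measurableT_comp (metahat l) (pair2_measurable x)).
  - move=> o; rewrite divr_ge0 ?(ltW tau0)//= ler_pdivrMr// mulVf ?gt_eqF//.
    case/andP: (reg.1 x l) => e0 e1; case/andP: (etahat01 o x l) => f0 f1.
    by rewrite ler_norml; apply/andP; split; lra.
  - move=> j; under eq_set do rewrite ler_pdivlMr//.
    exact: tail.
have S1 : (0 < S)%N by case/andP: S0.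
have HB1 := swap_level_integral (mu := marginal P) reg.1
  (measurable_regression reg) msigma bL C00 a10 tau0 p1 S1 local_margin.
have HB2 := drop_level_integral (mu := marginal P) reg.1
  (measurable_regression reg) msigma a20 tau0 p2 h0 hCh global_margin.
have := expected_risk_le reg msigma ssigma metahat etahat01 msigmahat ssigmahat
  bL tau0 (ltW M0) cstar (sparse_ae reg sparse) moment HB1 HB2.
rewrite leeBlDr// -EFinD => /le_trans; apply.
rewrite lee_fin addrC lerD2r.
set a := Num.min alpha2 alpha1.
have -> : N%:R `^ (- (gamma * a / 2)) = tau `^ a.
  by rewrite /tau -powRrM; congr (_ `^ _); field.
(* As [tau <= 1], the smaller exponent gives the larger power. *)
have ta1 : tau `^ alpha1 <= tau `^ a.
  by apply: ger_powR; rewrite ?tau0// ge_min lexx orbT.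
have ta2 : tau `^ alpha2 <= tau `^ a.
  by apply: ger_powR; rewrite ?tau0// ge_min lexx.
have LB : 0 <= L%:R - beta%:R :> R by rewrite subr_ge0 ler_nat; case/andP: bL.
have Li : 0 <= L%:R^-1 :> R by rewrite invr_ge0.
rewrite powRM ?(ltW tau0)// -/c.
set u := tau `^ a in ta1 ta2 *; set B := beta%:R `^ alpha2.
have u0 : 0 <= u by rewrite powR_ge0.
have B0 : 0 <= B by rewrite powR_ge0.
move: (L%:R - beta%:R) LB (L%:R^-1) Li (2 `^ alpha1) b0 (S%:R) (ler0n R S) =>
  m m0 q q0 b b0 z z0.
have [c0' C0' b0' Ch0' M0'] :=
  And5 (ltW c0) (ltW C00) (ltW b0) (ltW Ch0) (ltW M0).
apply: (@le_trans _ _ (q * (M * (3 * (z * m) * (c * (C0 * (b * u))) +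
                                 c * (B * u * (Ch * m)))))).
  do 2![apply: ler_wpM2l => //]; apply: lerD.
    apply: ler_wpM2l; first by rewrite !mulr_ge0.
    by do 3![apply: ler_wpM2l => //].
  apply: ler_wpM2l => //; apply: ler_wpM2r; first by rewrite mulr_ge0.
  exact: ler_wpM2l.
rewrite -subr_ge0.
set D' := (X in 0 <= X).
(* The difference of the two sides consists of the cross terms added by factoring the sum into a
   product. *)
have -> : D' = q * M * c * m * u * (3 * (C0 * b) * B + Ch * z) by rewrite /D'; ring.
apply: mulr_ge0; first by do 4![apply: mulr_ge0 => //].
by apply: addr_ge0; do 3?[apply: mulr_ge0 => //].
Qed.
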